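(* Let $\mathbf{k}$ be a field, $X$ a well-ordered set, $I$ an ideal of the free dialgebra $Di\langle X\rangle$ over $\mathbf{k}$, and $>$ a monomial-center ordering on $[X^+]_\omega$. Then there is a unique reduced Gröbner-Shirshov basis for $I$.
   Context: Free dialgebra. A dialgebra over $\mathbf{k}$ is a $\mathbf{k}$-module with two $\mathbf{k}$-bilinear associative products $\vdash,\dashv$ satisfying $a\dashv(b\vdash c)=a\dashv(b\dashv c)$, $(a\dashv b)\vdash c=(a\vdash b)\vdash c$, $a\vdash(b\dashv c)=(a\vdash b)\dashv c$. $X^+$ is the set of nonempty words on $X$, $X^*$ the set of all words including the empty one, $|u|$ the length of $u$. $[X^+]_\omega=\{[u]_m\mid u\in X^+,\ 1\le m\le |u|\}$ is the set of normal diwords (formal pairs $(u,m)$); $u$ is the associative word and $p([u]_m)=m$ the position of center. $Di\langle X\rangle$ is the $\mathbf{k}$-space with basis $[X^+]_\omega$ and products $[u]_m\vdash[v]_n=[uv]_{|u|+n}$, $[u]_m\dashv[v]_n=[uv]_m$ extended bilinearly; it is the free dialgebra on $X$ ($x\in X$ is identified with $[x]_1$). An ideal is a subspace closed under both products, on both sides, with arbitrary elements; $Id(S)$ is the ideal generated by $S$. Orderings. A monomial ordering on $X^+$ is a well (total) ordering with $u>v\Rightarrow uw>vw,\ wu>wv$. The associated monomial-center ordering on $[X^+]_\omega$ is: $[u]_m>[v]_n$ iff $(u,m)>(v,n)$ lexicographically. For $0\ne f\in Di\langle X\rangle$: $\overline f$ is the leading (largest) normal diword of $f$, $lc(f)$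 its coefficient, $lt(f)=lc(f)\overline f$, $\widetilde f$ the associative word of $\overline f$, $r_f=f-lt(f)$. By convention $0$ is smaller than every diword and every word, and $\overline 0=\widetilde 0=0$. $f\neq0$ is monic if $lc(f)=1$; a set is monic if all its elements are. $f\ne0$ is strong if $\widetilde f>\widetilde{r_f}$ (in particular if $r_f=0$). Normal $S$-diwords ($S$ monic). For $s\in S$, $a,b\in X^*$ put $P([asb])=\{n: 1\le n\le|a|\}\cup\{|a|+p(\overline s)\}\cup\{n:|a\widetilde s|<n\le|a\widetilde sb|\}$ if $s$ is strong, and $P([asb])=\{|a|+p(\overline s)\}$ if $s$ is not strong. For $l\in P([asb])$ the normal $S$-diword (normal $s$-diword) $[asb]_l$ is the element: $[a]_l\dashv s\dashv[b]_1$ if $l\le|a|$; $[a]_{|a|}\vdash s\dashv[b]_1$ if $l=|a|+p(\overline s)$; $[a]_{|a|}\vdash s\vdash[b]_{l-|a\widetilde s|}$ if $l>|a\widetilde s|$ (factors with empty word omitted). One has $\overline{[asb]_l}=[a\widetilde sb]_l$. $Irr(S)$ is the set of $[u]_n\in[X^+]_\omega$ not equal to $\overline{[asb]_m}$ for any normal $S$-diword $[asb]_m$. Compositions of monic $f,g\in Di\langle X\rangle$ (same notation $[afb]_l$, $P$ used for single polynomials): 1) If $f$ is not strong: $x\dashv f$ for all $x\in X$ (left multiplication) and $f\vdash[u]_{|u|}$ for all $u\in X^+$ (right multiplication). 2) If $w=\widetilde f=a\widetilde gb$, $a,b\in X^*$: if $p(\overline f)\in P([agb])$, the composition of inclusion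 $f-[agb]_{p(\overline f)}$; if $p(\overline f)\notin P([agb])$ and both $f,g$ are strong, for every $x\in X$ the compositions of left and right multiplicative inclusion $[xf]_1-[xagb]_1$ and $[fx]_{|wx|}-[agbx]_{|wx|}$. 3) If $w=\widetilde fb=a\widetilde g$, $a,b\in X^*$, $|\widetilde f|+|\widetilde g|>|w|$: if $P([fb])\cap P([ag])\ne\varnothing$, for every $m$ in it the composition of intersection $[fb]_m-[ag]_m$; if $P([fb])\cap P([ag])=\varnothing$ and both $f,g$ are strong, for every $x\in X$ the compositions of left and right multiplicative intersection $[xfb]_1-[xag]_1$ and $[fbx]_{|wx|}-[agx]_{|wx|}$. $h\in Di\langle X\rangle$ is trivial modulo $S$ if $h=\sum\alpha_i[a_is_ib_i]_{m_i}$ is a finite sum with $\alpha_i\in\mathbf{k}$, $[a_is_ib_i]_{m_i}$ normal $S$-diwords and $\overline{[a_is_ib_i]_{m_i}}\le\overline h$. A monic set $S$ is a Gröbner-Shirshov basis in $Di\langle X\rangle$ if every composition of elements of $S$ is trivial modulo $S$; it is a Gröbner-Shirshov basis for the ideal $I$ if moreover $I=Id(S)$. A Gröbner-Shirshov basis $S$ is reduced if for every $s\in S$, $supp(s)\subseteq Irr(S\setminus\{s\})$, where $supp(s)$ is the set of normal diwords occurring in $s$ with nonzero coefficient. *)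

(* Defs.v *)
From HB Require Import structures.
From mathcomp Require Import all_boot all_algebra finmap.
From mathcomp Require Import boolp classical_sets wochoice.
From mathcomp.multinomials Require Import monalg.

Set Implicit Arguments.
Unset Strict Implicit.
Unset Printing Implicit Defensive.

Import GRing.Theory.
Local Open Scope ring_scope.
Local Open Scope classical_set_scope.

Reserved Notation "f ⊢ g" (at level 45, left associativity).
Reserved Notation "f ⊣ g" (at level 45, left associativity).

(* [diword X] is [X^+]_omega: the pair (u, m) stands for [u]_m.  The condition
   1 <= m <= |u| already forces u to be nonempty. *)
Record diword (X : choiceType) := Diword {
  diword_val :> seq X * nat;
  diword_prop : (0 < diword_val.2 <= size diword_val.1)%N
}.
Arguments Diword {X} _ _.

HB.instance Definition _ (X : choiceType) := [isSub for @diword_val X].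
HB.instance Definition _ (X : choiceType) := [Choice of diword X by <:].

Section DiwordProducts.
Variable X : choiceType.
Implicit Types c d : diword X.

Fact diword_vdash_subproof c d :
  (0 < (size c.1 + d.2)%N <= size (c.1 ++ d.1))%N.
Proof.
case: d => [[v n] /= /andP[n_gt0 n_le]].
by rewrite size_cat leq_add2l n_le addn_gt0 n_gt0 orbT.
Qed.

Fact diword_dashv_subproof c d : (0 < c.2 <= size (c.1 ++ d.1))%N.
Proof.
case: c => [[u m] /= /andP[-> m_le]].
by rewrite size_cat (leq_trans m_le) ?leq_addr.
Qed.

Definition diword_vdash c d : diword X :=
  Diword (c.1 ++ d.1, (size c.1 + d.2)%N) (diword_vdash_subproof c d).

Definition diword_dashv c d : diword X :=
  Diword (c.1 ++ d.1, c.2) (diword_dashv_subproof c d).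

End DiwordProducts.

Definition Di (k : fieldType) (X : choiceType) := {malg k[diword X]}.

Section FreeDialgebra.
Variables (k : fieldType) (X : choiceType).
Implicit Types (f g : Di k X) (I S : set (Di k X)).

Definition vdash f g : Di k X :=
  \sum_(c <- msupp f) \sum_(d <- msupp g)
    << f@_c * g@_d *g diword_vdash c d >>.

Definition dashv f g : Di k X :=
  \sum_(c <- msupp f) \sum_(d <- msupp g)
    << f@_c * g@_d *g diword_dashv c d >>.

(* The basis element [u]_m; the value 0 when m is not a position in u is
   never used. *)
Definition diw (u : seq X) (m : nat) : Di k X :=
  if insub (u, m) is Some c then << c >> else 0.

Definition is_ideal I : Prop :=
  [/\ I 0,
      forall (a : k) f g, I f -> I g -> I (a *: f + g)
    & forall f g, I f -> [/\ I (vdash f g), I (vdash g f),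
                             I (dashv f g) & I (dashv g f)]].

Definition ideal_gen S : set (Di k X) := smallest is_ideal S.

End FreeDialgebra.

Notation "f ⊢ g" := (vdash f g) : ring_scope.
Notation "f ⊣ g" := (dashv f g) : ring_scope.

Section MonomialOrder.
Variables (X : choiceType) (leW : rel (seq X)).

(* [leW] is the reflexive form of the ordering; only its restriction to
   nonempty words is constrained, and only that restriction is ever used. *)
Definition ltW (u v : seq X) : bool := (u != v) && leW u v.

Definition monomial_order : Prop :=
  wo_chain leW [pred u : seq X | u != [::]] /\
  forall u v w : seq X, u != [::] -> v != [::] -> w != [::] ->
    ltW v u -> ltW (v ++ w) (u ++ w) /\ ltW (w ++ v) (w ++ u).

Definition ltD (c d : diword X) : bool :=
  ltW c.1 d.1 || (c.1 == d.1) && (c.2 < d.2)%N.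

Definition leD (c d : diword X) : bool := (c == d) || ltD c d.

(* Diwords together with 0, which is encoded by [None] and is the smallest
   element. *)
Definition leD0 (c d : option (diword X)) : bool :=
  match c, d with
  | None, _ => true
  | Some _, None => false
  | Some c, Some d => leD c d
  end.

Definition maxD0 (c d : option (diword X)) : option (diword X) :=
  if leD0 c d then d else c.

End MonomialOrder.

Section GroebnerShirshov.
Variables (k : fieldType) (X : choiceType) (leW : rel (seq X)).
Implicit Types (f g h s : Di k X) (a b u : seq X) (l m : nat).
Implicit Types (S I : set (Di k X)).

Definition lead f : option (diword X) :=
  \big[maxD0 leW/None]_(c <- msupp f) Some c.

Definition lc f : k := if lead f is Some c then f@_c else 0.

Definition lterm f : Di k X := if lead f is Some c then << lc f *g c >> else 0.

Definition rest f : Di k X := f - lterm f.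

(* Associative word and position of center of the leading diword; the empty
   word and the position 0 are returned for f = 0. *)
Definition lword f : seq X := if lead f is Some c then c.1 else [::].
Definition lpos f : nat := if lead f is Some c then c.2 else 0%N.

Definition monic f : bool := (f != 0) && (lc f == 1).

Definition strong f : bool :=
  (f != 0) && ((rest f == 0) || ltW leW (lword (rest f)) (lword f)).

(* l \in P([a s b]) *)
Definition inP s a b l : bool :=
  (l == size a + lpos s)%N ||
  strong s && ((0 < l <= size a)%N ||
               (size (a ++ lword s) < l <= size (a ++ lword s ++ b))%N).

Definition lmul (op : Di k X -> Di k X -> Di k X) a m f : Di k X :=
  if a is [::] then f else op (diw k a m) f.
Definition rmul (op : Di k X -> Di k X -> Di k X) f b m : Di k X :=
  if b is [::] then f else op f (diw k b m).

(* The normal s-diword [a s b]_l, meaningful when [inP s a b l]. *)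
Definition ndiw s a b l : Di k X :=
  if (l <= size a)%N then
    rmul (@dashv k X) (lmul (@dashv k X) a l s) b 1
  else if l == (size a + lpos s)%N then
    rmul (@dashv k X) (lmul (@vdash k X) a (size a) s) b 1
  else
    rmul (@vdash k X) (lmul (@vdash k X) a (size a) s) b
         (l - size (a ++ lword s)).

Definition Irr S : set (diword X) :=
  [set c | ~ exists s a b l,
             [/\ S s, inP s a b l & lead (ndiw s a b l) = Some c]].

Inductive composition S : Di k X -> Prop :=
| LeftMul f (x : X) of S f & ~~ strong f :
    composition S (diw k [:: x] 1 ⊣ f)
| RightMul f u of S f & ~~ strong f & u != [::] :
    composition S (f ⊢ diw k u (size u))
| Inclusion f g a b of S f & S g & lword f = a ++ lword g ++ b
    & inP g a b (lpos f) :
    composition S (f - ndiw g a b (lpos f))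
| LeftMulInclusion f g a b (x : X) of S f & S g
    & lword f = a ++ lword g ++ b & ~~ inP g a b (lpos f)
    & strong f & strong g :
    composition S (ndiw f [:: x] [::] 1 - ndiw g (x :: a) b 1)
| RightMulInclusion f g a b (x : X) of S f & S g
    & lword f = a ++ lword g ++ b & ~~ inP g a b (lpos f)
    & strong f & strong g :
    let l := (size (lword f)).+1 in
    composition S (ndiw f [::] [:: x] l - ndiw g a (rcons b x) l)
| Intersection f g a b m of S f & S g & lword f ++ b = a ++ lword g
    & (size (lword f ++ b) < size (lword f) + size (lword g))%N
    & inP f [::] b m & inP g a [::] m :
    composition S (ndiw f [::] b m - ndiw g a [::] m)
| LeftMulIntersection f g a b (x : X) of S f & S g
    & lword f ++ b = a ++ lword g
    & (size (lword f ++ b) < size (lword f) + size (lword g))%N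
    & (forall m, ~~ (inP f [::] b m && inP g a [::] m))
    & strong f & strong g :
    composition S (ndiw f [:: x] b 1 - ndiw g (x :: a) [::] 1)
| RightMulIntersection f g a b (x : X) of S f & S g
    & lword f ++ b = a ++ lword g
    & (size (lword f ++ b) < size (lword f) + size (lword g))%N
    & (forall m, ~~ (inP f [::] b m && inP g a [::] m))
    & strong f & strong g :
    let l := (size (lword f ++ b)).+1 in
    composition S (ndiw f [::] (rcons b x) l - ndiw g a [:: x] l).

Definition trivial_mod S h : Prop :=
  exists (n : nat) (alpha : 'I_n -> k) (s : 'I_n -> Di k X)
         (a b : 'I_n -> seq X) (m : 'I_n -> nat),
    (forall i, [/\ S (s i), inP (s i) (a i) (b i) (m i)
                 & leD0 leW (lead (ndiw (s i) (a i) (b i) (m i))) (lead h)]) /\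
    h = \sum_(i < n) alpha i *: ndiw (s i) (a i) (b i) (m i).

Definition gs_basis S : Prop :=
  (forall s, S s -> monic s) /\ (forall h, composition S h -> trivial_mod S h).

Definition gs_basis_for I S : Prop := gs_basis S /\ I = ideal_gen S.

Definition reduced S : Prop :=
  forall s, S s -> forall c, c \in msupp s -> Irr (S `\ s) c.

Definition reduced_gs_basis_for I S : Prop := gs_basis_for I S /\ reduced S.

End GroebnerShirshov.

(* Main.v *)
(* Write a normal S-diword as the image of s under a context that surrounds a word; the
   context either keeps the center of its argument or, when s is strong, places the
   center in the surrounding word and forgets the one of the argument.

   If S is a Groebner-Shirshov basis, the compositions of left and right multiplication
   show that the image of s in S under any context is a combination of normal S-diwords
   with leading diwords at most the expected one; so these combinations form the ideal
   Id(S).  Two normal S-diwords with the same leading diword are images under a common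
   context of the two terms of a composition, or have disjoint factors; in both cases
   their difference is a combination of normal S-diwords with smaller leading diwords.
   Hence the leading diword of any element of Id(S) is that of a normal S-diword.
   Conversely, by division, a monic set S contained in I whose normal S-diwords realise
   all leading diwords of I is a Groebner-Shirshov basis of I.

   For each leading diword c of I there is a unique monic f_c in I with leading diword c
   and no other diword of its support a leading diword of I.  A reduced basis must
   consist of such f_c, and the set of the c that occur satisfies, and is determined by,
   a well-founded recursion: c occurs iff it is not the leading diword of a normal
   f_d-diword with d < c that occurs. *)

From HB Require Import structures.
Require Import Defs.
From mathcomp Require Import all_boot all_algebra finmap zify.
From mathcomp Require Import boolp classical_sets wochoice.
From mathcomp.multinomials Require Import monalg.

Set Implicit Arguments.
Unset Strict Implicit.
Unset Printing Implicit Defensive.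

Import GRing.Theory.
Local Open Scope ring_scope.
Local Open Scope classical_set_scope.

(** * The monomial-center ordering *)

Section DiwordOrder.
Variables (X : choiceType) (leW : rel (seq X)).
Hypothesis leW_monomial : monomial_order leW.
Implicit Types (u v w : seq X) (c d e : diword X).

Lemma diword_eqP c d : c.1 = d.1 -> c.2 = d.2 -> c = d.
Proof.
by move=> e1 e2; apply: val_inj; rewrite [LHS]surjective_pairing e1 e2 -surjective_pairing.
Qed.

Lemma diword_pos c : (0 < c.2 <= size c.1)%N.
Proof. exact: diword_prop. Qed.

Lemma diword_neq0 c : c.1 != [::].
Proof. by case: c => [[[|x u] m]] //=; case: m. Qed.

Lemma leW_total u v : u != [::] -> v != [::] -> leW u v || leW v u.
Proof. by case: leW_monomial => /wo_chainW + _ => /[apply]/[apply]. Qed.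

Lemma leW_anti u v : u != [::] -> v != [::] -> leW u v -> leW v u -> u = v.
Proof.
case: leW_monomial => /wo_chain_antisymmetric anti _ un0 vn0 uv vu.
by apply: anti => //; rewrite ?inE ?uv.
Qed.

Lemma leW_min (A : {pred seq X}) u : u \in A -> [::] \notin A ->
  exists2 v, v \in A & {in A, forall w, leW v w}.
Proof.
case: leW_monomial => wo _ Au A0.
have sub : sub_mem (mem A) (mem [pred u : seq X | u != [::]]).
  by move=> v /= Av; apply: contraNneq A0 => <-.
have [|v [[Av vmin] _]] := wo _ sub; first by exists u.
by exists v.
Qed.

(** Transitivity comes from the well-ordering: a least element of the three words exists, and
    antisymmetry settles the cases where it is [v] or [w]. *)
Lemma leW_trans v u w : u != [::] -> v != [::] -> w != [::] ->
  leW u v -> leW v w -> leW u w.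
Proof.
move=> un0 vn0 wn0 uv vw.
have [|/=|z /=] := @leW_min [pred t | t \in [:: u; v; w]] u.
- by rewrite !inE eqxx.
- by rewrite !inE; case: u v w un0 vn0 wn0 {uv vw} => [|? ?] [|? ?] [|? ?].
rewrite !inE => zin zmin.
have zu : leW z u by apply: zmin; rewrite !inE eqxx.
have zv : leW z v by apply: zmin; rewrite !inE eqxx orbT.
have zw : leW z w by apply: zmin; rewrite !inE eqxx !orbT.
case/or3P: zin => /eqP ez; subst z => //.
- by rewrite (leW_anti un0 vn0 uv zu).
- by rewrite -(leW_anti vn0 wn0 vw zv).
Qed.

Lemma ltW_irr u : ltW leW u u = false.
Proof. by rewrite /ltW eqxx. Qed.

Lemma ltW_trans v u w : u != [::] -> v != [::] -> w != [::] ->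
  ltW leW u v -> ltW leW v w -> ltW leW u w.
Proof.
move=> un0 vn0 wn0 /andP[nuv uv] /andP[nvw vw]; rewrite /ltW (leW_trans _ _ _ uv) //.
rewrite andbT; apply: contra_neq nuv => e; subst w.
exact: leW_anti.
Qed.

(** [monomial_order] speaks of nonempty factors only, so empty [a] and [b] are treated apart. *)
Lemma ltW_cat a b u v : u != [::] -> v != [::] ->
  ltW leW u v -> ltW leW (a ++ u ++ b) (a ++ v ++ b).
Proof.
case: leW_monomial => _ mon un0 vn0 uv.
have uvb : ltW leW (u ++ b) (v ++ b).
  have [->|bn0] := eqVneq b [::]; first by rewrite !cats0.
  by have [] := mon v u b.
have [->//|an0] := eqVneq a [::].
have n0 t : t != [::] -> t ++ b != [::] by case: t.
by have [] := mon (v ++ b) (u ++ b) a (n0 _ vn0) (n0 _ un0) an0 uvb.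
Qed.

Lemma ltD_irr c : ltD leW c c = false.
Proof. by rewrite /ltD ltW_irr ltnn andbF. Qed.

Lemma ltD_trans d c e : ltD leW c d -> ltD leW d e -> ltD leW c e.
Proof.
rewrite /ltD => /orP[cd|/andP[/eqP cd pcd]] /orP[de|/andP[/eqP de pde]].
- by rewrite (ltW_trans _ _ _ cd de) ?diword_neq0.
- by rewrite -de cd.
- by rewrite cd de.
- by rewrite cd de eqxx (ltn_trans pcd pde) orbT.
Qed.

Lemma leD_refl c : leD leW c c.
Proof. by rewrite /leD eqxx. Qed.

Lemma ltDW c d : ltD leW c d -> leD leW c d.
Proof. by rewrite /leD => ->; rewrite orbT. Qed.

Lemma leDP c d : leD leW c d -> c = d \/ ltD leW c d.
Proof. by case/orP => [/eqP|]; [left|right]. Qed.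

Lemma leD_ltD_trans d c e : leD leW c d -> ltD leW d e -> ltD leW c e.
Proof. by case/leDP => [->//|]; apply: ltD_trans. Qed.

Lemma ltD_leD_trans d c e : ltD leW c d -> leD leW d e -> ltD leW c e.
Proof. by move=> cd /leDP[<-//|]; apply: ltD_trans. Qed.

Lemma leD_trans d c e : leD leW c d -> leD leW d e -> leD leW c e.
Proof. by case/leDP => [->//|cd /(ltD_leD_trans cd)/ltDW]. Qed.

Lemma ltD_total c d : c != d -> ltD leW c d || ltD leW d c.
Proof.
move=> ncd; rewrite /ltD /ltW (eq_sym d.1).
have [e1|n1] := eqVneq c.1 d.1; last first.
  by have /orP[->|->] := leW_total (diword_neq0 c) (diword_neq0 d); rewrite ?orbT.
rewrite /= -neq_ltn; apply: contra_neq ncd; exact: diword_eqP.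
Qed.

Lemma leD_anti c d : leD leW c d -> leD leW d c -> c = d.
Proof. by move=> cd /leDP[//|/(leD_ltD_trans cd)]; rewrite ltD_irr. Qed.

Lemma nltD c d : ~~ ltD leW c d -> leD leW d c.
Proof.
rewrite /leD; have [//|ne] := eqVneq d c.
by have /orP[->//|->] := ltD_total ne.
Qed.

Lemma ltW_wf (P : seq X -> Prop) :
  (forall u, u != [::] -> (forall v, v != [::] -> ltW leW v u -> P v) -> P u) ->
  forall u, u != [::] -> P u.
Proof.
move=> ih u un0; case: (pselect (P u)) => // nPu.
have [||v] := @leW_min [pred v | (v != [::]) && ~~ `[< P v >]] u.
- by rewrite inE un0 /=; apply/asboolPn.
- by rewrite inE.
rewrite inE => /andP[vn0 /asboolPn nPv] vmin.
case: nPv; apply: ih => // w wn0 /andP[nwv wv].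
apply: contrapT => nPw; move/eqP: nwv; apply; apply: leW_anti => //.
by apply: vmin; rewrite inE wn0 /=; apply/asboolPn.
Qed.

(** Lexicographic product: the outer induction is on the word, the inner one on the center. *)
Lemma ltD_wf : well_founded (ltD leW).
Proof.
move=> c; have := diword_neq0 c; move: {-1}c.1 (erefl c.1) => u cu un0.
elim/ltW_wf: u / un0 c cu => u _ ihu c.
move: {-1}c.2 (erefl c.2) => n.
elim/ltn_ind: n c => n ihn c cn cu.
split=> d; rewrite /ltD cu cn => /orP[dc|/andP[/eqP dc pdc]].
- by apply: (ihu d.1) => //; exact: diword_neq0.
- exact: (ihn d.2).
Qed.

End DiwordOrder.

(** * Linear maps, spans and leading terms *)

Section LinearAlgebra.
Variables (k : fieldType) (X : choiceType).
Implicit Types (f g h : Di k X) (c d : diword X) (phi psi : diword X -> diword X).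
Implicit Types (G : set (Di k X)).

(** The linear extension of [phi]. Context maps that forget the center are not injective, so
    coefficients may merge. *)
Definition dlift phi f : Di k X := \sum_(c <- msupp f) << f@_c *g phi c >>.

Lemma dliftEw phi f (D : {fset diword X}) : (msupp f `<=` D)%fset ->
  dlift phi f = \sum_(c <- D) << f@_c *g phi c >>.
Proof.
move=> le; rewrite /dlift [LHS](big_fset_incl _ le) => //= x xD /mcoeff_outdom ->.
by rewrite monalgU0.
Qed.

Lemma scale_malgU (a b : k) c : a *: << b *g c >> = << a * b *g c >> :> Di k X.
Proof. by apply/malgP => d; rewrite mcoeffZ [in LHS]mcoeffU [in RHS]mcoeffU mulrnAr. Qed.

Lemma dlift_is_linear phi : linear (dlift phi).
Proof.
move=> a f g; pose D := (msupp f `|` msupp g `|` msupp (a *: f + g))%fset.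
rewrite !(@dliftEw _ _ D) /D.
- rewrite scaler_sumr -big_split /=; apply: eq_bigr => c _.
  by rewrite mcoeffD mcoeffZ monalgUD scale_malgU.
- by rewrite -fsetUA fsetUCA fsubsetUl.
- by rewrite -fsetUA fsubsetUl.
- exact: fsubsetUr.
Qed.

HB.instance Definition _ phi :=
  GRing.isLinear.Build k (Di k X) (Di k X) _ (dlift phi) (dlift_is_linear phi).

Lemma dliftU phi (a : k) c : dlift phi << a *g c >> = << a *g phi c >>.
Proof. by rewrite (dliftEw _ msuppU_le) big_seq_fset1 mcoeffUU. Qed.

Lemma dlift_comp phi psi f : dlift phi (dlift psi f) = dlift (phi \o psi) f.
Proof. by rewrite [dlift psi f]/dlift linear_sum; apply: eq_bigr => c _; rewrite /= dliftU. Qed.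

Lemma eq_dlift phi psi : phi =1 psi -> dlift phi =1 dlift psi.
Proof. by move=> e f; apply: eq_bigr => c _; rewrite e. Qed.

Lemma dlift_id f : dlift id f = f.
Proof. by rewrite [RHS]monalgE. Qed.

Lemma mcoeff_dlift phi f d :
  (dlift phi f)@_d = \sum_(c <- msupp f) f@_c *+ (phi c == d).
Proof. by rewrite raddf_sum; apply: eq_bigr => c _; rewrite /= mcoeffU. Qed.

Lemma msupp_dlift phi f d : d \in msupp (dlift phi f) ->
  exists2 c, c \in msupp f & d = phi c.
Proof.
move=> din; apply: contrapT => nex; move: din; rewrite -mcoeff_neq0.
apply/negP/negPn/eqP; rewrite mcoeff_dlift big_seq big1 // => c cf.
by have [e|//] := eqVneq; case: nex; exists c.
Qed.

(** Expanding along one factor turns multiplication by an arbitrary element into a combination of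
    maps [dlift], one for each diword of that factor. *)
Lemma dashvE f g : f ⊣ g = \sum_(c <- msupp f) f@_c *: dlift (diword_dashv c) g.
Proof.
apply: eq_bigr => c _; rewrite linear_sum; apply: eq_bigr => d _.
by rewrite /= scale_malgU.
Qed.

Lemma dashvE' f g : f ⊣ g = \sum_(d <- msupp g) g@_d *: dlift (fun c => diword_dashv c d) f.
Proof.
rewrite /dashv exchange_big; apply: eq_bigr => d _.
rewrite linear_sum; apply: eq_bigr => c _.
by rewrite /= scale_malgU mulrC.
Qed.

Lemma vdashE f g : f ⊢ g = \sum_(c <- msupp f) f@_c *: dlift (diword_vdash c) g.
Proof.
apply: eq_bigr => c _; rewrite linear_sum; apply: eq_bigr => d _.
by rewrite /= scale_malgU.
Qed.

Lemma vdashE' f g : f ⊢ g = \sum_(d <- msupp g) g@_d *: dlift (fun c => diword_vdash c d) f.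
Proof.
rewrite /vdash exchange_big; apply: eq_bigr => d _.
rewrite linear_sum; apply: eq_bigr => c _.
by rewrite /= scale_malgU mulrC.
Qed.

Lemma sum_malg1 c (F : diword X -> Di k X) :
  \sum_(d <- msupp (<< c >> : Di k X)) (<< c >> : Di k X)@_d *: F d = F c.
Proof. by rewrite msuppU oner_eq0 big_seq_fset1 mcoeffUU scale1r. Qed.

Lemma dashv_diwl c f : << c >> ⊣ f = dlift (diword_dashv c) f.
Proof. by rewrite dashvE sum_malg1. Qed.
Lemma dashv_diwr c f : f ⊣ << c >> = dlift (fun d => diword_dashv d c) f.
Proof. by rewrite dashvE' sum_malg1. Qed.
Lemma vdash_diwl c f : << c >> ⊢ f = dlift (diword_vdash c) f.
Proof. by rewrite vdashE sum_malg1. Qed.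
Lemma vdash_diwr c f : f ⊢ << c >> = dlift (fun d => diword_vdash d c) f.
Proof. by rewrite vdashE' sum_malg1. Qed.

Inductive lspan G : Di k X -> Prop :=
| lspan0 : lspan G 0
| lspan_cons a g f of G g & lspan G f : lspan G (a *: g + f).

Lemma lspan_in G g : G g -> lspan G g.
Proof.
move=> Gg; rewrite -[g]scale1r -[1 *: g]addr0.
by apply: lspan_cons => //; apply: lspan0.
Qed.

Lemma lspanD G f g : lspan G f -> lspan G g -> lspan G (f + g).
Proof.
by elim=> [|a g' f' Gg' _ ih] Gg; rewrite ?add0r // -addrA; apply: lspan_cons; auto.
Qed.

Lemma lspanZ G a f : lspan G f -> lspan G (a *: f).
Proof.
elim=> [|b g' f' Gg' _ ih]; first by rewrite scaler0; apply: lspan0.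
by rewrite scalerDr scalerA; apply: lspan_cons.
Qed.

Lemma lspanB G f g : lspan G f -> lspan G g -> lspan G (f - g).
Proof. by move=> Gf Gg; rewrite -scaleN1r; apply: (lspanD Gf); exact: lspanZ. Qed.

Lemma lspan_sum G (J : eqType) (r : seq J) (F : J -> Di k X) :
  (forall i, i \in r -> lspan G (F i)) -> lspan G (\sum_(i <- r) F i).
Proof.
move=> GF; rewrite big_seq; apply: big_ind => //; [exact: lspan0 | exact: lspanD].
Qed.

Lemma lspan_dlift G G' phi f :
  (forall g, G g -> lspan G' (dlift phi g)) -> lspan G f -> lspan G' (dlift phi f).
Proof.
move=> GG'; elim=> [|a g f' Gg _ ih]; first by rewrite linear0; apply: lspan0.
rewrite dlift_is_linear; apply: lspanD ih; apply: lspanZ; exact: GG'.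
Qed.

Lemma lspan_sub G G' f : (forall g, G g -> lspan G' g) -> lspan G f -> lspan G' f.
Proof.
by move=> GG'; rewrite -[X in lspan G' X]dlift_id; apply: lspan_dlift => g /GG'; rewrite dlift_id.
Qed.

Lemma lspan_mono G G' f : G `<=` G' -> lspan G f -> lspan G' f.
Proof. by move=> GG'; apply: lspan_sub => g /GG'; apply: lspan_in. Qed.

End LinearAlgebra.

(** * Leading diwords, monic and strong elements *)

Section LeadingTerm.
Variables (k : fieldType) (X : choiceType) (leW : rel (seq X)).
Hypothesis leW_monomial : monomial_order leW.
Implicit Types (f g h s : Di k X) (c d : diword X).

Local Notation lead := (lead leW).
Local Notation ltD := (ltD leW).
Local Notation leD := (leD leW).
Local Notation ltW := (ltW leW).

Lemma bigmaxD0P (r : seq (diword X)) :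
  if \big[maxD0 leW/None]_(c <- r) Some c is Some c
  then c \in r /\ forall d, d \in r -> leD d c else r = [::].
Proof.
elim: r => [|x r]; first by rewrite big_nil.
rewrite big_cons; case: (\big[_/_]_(_ <- r) _) => [c [cr cmax]|->]; last first.
  rewrite /maxD0 /=; split; first by rewrite mem_head.
  by move=> d; rewrite inE => /eqP ->; apply: leD_refl.
rewrite /maxD0 /=; case: ifP => [xc|/negbT nxc].
  split=> [|d]; rewrite inE ?cr ?orbT // => /orP[/eqP->//|]; exact: cmax.
have cx : leD c x by apply: nltD => //; apply: contra nxc; exact: ltDW.
split=> [|d]; rewrite inE ?eqxx // => /orP[/eqP->|/cmax dc]; first exact: leD_refl.
exact: (leD_trans leW_monomial dc).
Qed.

Lemma lead_max f c : lead f = Some c ->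
  c \in msupp f /\ forall d, d \in msupp f -> leD d c.
Proof. by have := bigmaxD0P (msupp f); rewrite -/(lead f) => + e; rewrite e. Qed.

Lemma lead_None f : lead f = None -> f = 0.
Proof.
have := bigmaxD0P (msupp f); rewrite -/(lead f) => + e; rewrite e => s0.
by rewrite [f]monalgE s0 big_nil.
Qed.

Lemma lead0 : lead (0 : Di k X) = None.
Proof. by rewrite /Defs.lead msupp0 big_nil. Qed.

Lemma lead_neq0 f c : lead f = Some c -> f != 0.
Proof. by move=> lf; apply/eqP => f0; rewrite f0 lead0 in lf. Qed.

Lemma leadP f c : c \in msupp f -> (forall d, d \in msupp f -> leD d c) ->
  lead f = Some c.
Proof.
move=> cf cmax; case lf: (lead f) => [d|]; last first.
  by move: cf; rewrite (lead_None lf) msupp0.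
have [df dmax] := lead_max lf.
by rewrite (leD_anti leW_monomial (dmax _ cf) (cmax _ df)).
Qed.

(** Monic with leading diword [c], stated by coefficients so that it passes through maps without
    computing [lead]. *)
Definition mlead f c : Prop :=
  f@_c = 1 /\ forall d, d \in msupp f -> d != c -> ltD d c.

Lemma mlead_supp f c : mlead f c -> c \in msupp f.
Proof. by case=> fc _; rewrite -mcoeff_neq0 fc oner_eq0. Qed.

Lemma mlead_lead f c : mlead f c -> lead f = Some c.
Proof.
move=> mf; have [_ cmax] := mf; apply: leadP; first exact: mlead_supp.
move=> d df; have [->|ne] := eqVneq d c; [exact: leD_refl|exact/ltDW/cmax].
Qed.

Lemma mlead_neq0 f c : mlead f c -> f != 0.
Proof. by move/mlead_lead/lead_neq0. Qed.

Lemma dmonicP f : reflect (exists c, mlead f c) (Defs.monic leW f).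
Proof.
apply: (iffP idP) => [/andP[]|[c mf]]; last first.
  rewrite /Defs.monic (mlead_neq0 mf) /lc (mlead_lead mf).
  by case: mf => ->; rewrite eqxx.
rewrite /lc; case lf: (lead f) => [c|] f0 /eqP fc; last first.
  by move: f0; rewrite (lead_None lf) eqxx.
exists c; split=> // d df ne; have [_ cmax] := lead_max lf.
by case/leDP: (cmax _ df) => // e; rewrite e eqxx in ne.
Qed.

Lemma lead_mlead f c : lead f = Some c -> mlead ((f@_c)^-1 *: f) c.
Proof.
move=> lf; have [cf cmax] := lead_max lf.
have fc0 : f@_c != 0 by rewrite mcoeff_neq0.
split; first by rewrite mcoeffZ mulVf.
move=> d; rewrite msuppZ invr_eq0 (negbTE fc0) => /cmax /leDP[->|//].
by rewrite eqxx.
Qed.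

Lemma mlead_lword f c : mlead f c -> lword leW f = c.1.
Proof. by rewrite /lword => /mlead_lead ->. Qed.

Lemma mlead_lpos f c : mlead f c -> lpos leW f = c.2.
Proof. by rewrite /lpos => /mlead_lead ->. Qed.

Lemma mlead_rest f c : mlead f c -> rest leW f = f - << c >>.
Proof.
move=> mf; rewrite /rest /lterm (mlead_lead mf) /lc (mlead_lead mf).
by case: mf => ->.
Qed.

Lemma msupp_rest f c d : mlead f c ->
  (d \in msupp (f - << c >>)) = (d \in msupp f) && (d != c).
Proof.
move=> [fc _]; rewrite -!mcoeff_neq0 mcoeffB mcoeffU (eq_sym c).
have [->|_] := eqVneq d c; first by rewrite fc subrr eqxx andbF.
by rewrite subr0 andbT.
Qed.

(** Every other diword of the support has word at most [c.1], so strength only excludes a second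
    diword on the word [c.1] with a smaller center. *)
Lemma strongP f c : mlead f c ->
  reflect (forall d, d \in msupp f -> d != c -> ltW d.1 c.1) (strong leW f).
Proof.
move=> mf; rewrite /strong (mlead_neq0 mf) (mlead_rest mf) (mlead_lword mf) /=.
apply: (iffP orP) => [[/eqP e|lt0] d df ne|lt].
- by have := msupp_rest d mf; rewrite df ne e msupp0.
- move: lt0; rewrite /lword; case lr: (lead (f - << c >>)) => [e|]; last first.
    by have := msupp_rest d mf; rewrite df ne (lead_None lr) msupp0.
  move=> ec; have [_ /(_ d)] := lead_max lr; rewrite (msupp_rest _ mf) df.
  move/(_ ne)/leDP => [->//|/orP[de|/andP[/eqP-> _]//]].
  by apply: (ltW_trans _ _ _ _ de ec) => //; exact: diword_neq0.
- rewrite /lword; case lr: (lead (f - << c >>)) => [e|]; last by rewrite (lead_None lr) eqxx; left.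
  right; have [] := lead_max lr; rewrite (msupp_rest _ mf) => /andP[ef ne] _.
  exact: lt.
Qed.

Lemma msuppB_neq f g c e : f@_c = 1 -> g@_c = 1 -> e \in msupp (f - g) -> e != c.
Proof.
move=> fc gc; apply: contraTneq => ->.
by rewrite -mcoeff_neq0 mcoeffB fc gc subrr eqxx.
Qed.

End LeadingTerm.

(** * Contexts *)

Section Contexts.
Variables (X : choiceType).
Implicit Types (a b : seq X) (c d D : diword X).

Fact lcat_subproof a D : (0 < (size a + D.2)%N <= size (a ++ D.1))%N.
Proof.
by have /andP[D0 D1] := diword_pos D; rewrite size_cat leq_add2l D1 addn_gt0 D0 orbT.
Qed.

Fact rcat_subproof D b : (0 < D.2 <= size (D.1 ++ b))%N.
Proof.
by have /andP[-> D1] := diword_pos D; rewrite size_cat (leq_trans D1) ?leq_addr.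
Qed.

Definition lcat a D : diword X := Diword (a ++ D.1, size a + D.2)%N (lcat_subproof a D).
Definition rcat D b : diword X := Diword (D.1 ++ b, D.2) (rcat_subproof D b).

(* [Left D b] is D ⊣ _ ⊣ b and [Right a D] is a ⊢ _ ⊢ D; there the center comes from D,
   while [Mid a b] is a ⊢ _ ⊣ b and keeps the center of its argument. *)
Inductive ctx := Mid of seq X & seq X | Left of diword X & seq X | Right of seq X & diword X.

Definition is_mid K := if K is Mid _ _ then true else false.
Definition lw K := match K with Mid a _ => a | Left D _ => D.1 | Right a _ => a end.
Definition rw K := match K with Mid _ b => b | Left _ b => b | Right _ D => D.1 end.

Definition act K c : diword X :=
  match K with
  | Mid a b => lcat a (rcat c b)
  | Left D b => rcat D (c.1 ++ b)
  | Right a D => lcat (a ++ c.1) D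
  end.

(** An outer context that places the center itself retains only the surrounding words of the inner
    one. *)
Definition ccomp K K' : ctx :=
  match K, K' with
  | Mid a b, Mid a' b' => Mid (a ++ a') (b' ++ b)
  | Mid a b, Left D b' => Left (lcat a D) (b' ++ b)
  | Mid a b, Right a' D => Right (a ++ a') (rcat D b)
  | Left D b, K' => Left (rcat D (lw K')) (rw K' ++ b)
  | Right a D, K' => Right (a ++ lw K') (lcat (rw K') D)
  end.

Lemma act_word K c : (act K c).1 = lw K ++ c.1 ++ rw K.
Proof. by case: K => //= a D; rewrite catA. Qed.

Lemma lw_comp K K' : lw (ccomp K K') = lw K ++ lw K'.
Proof. by case: K K' => [a b|D b|a D] []. Qed.

Lemma rw_comp K K' : rw (ccomp K K') = rw K' ++ rw K.
Proof. by case: K K' => [a b|D b|a D] []. Qed.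

Lemma act_comp K K' c : act (ccomp K K') c = act K (act K' c).
Proof.
apply: diword_eqP; first by rewrite !act_word lw_comp rw_comp !catA.
by case: K K' => [a b|D b|a D] [a' b'|D' b'|a' D'] /=;
  rewrite ?size_cat ?size_cat ?addnA //= ?size_cat; lia.
Qed.

Lemma is_mid_comp K K' : is_mid (ccomp K K') = is_mid K && is_mid K'.
Proof. by case: K K' => [a b|D b|a D] []. Qed.

Lemma act_collapse K c d : ~~ is_mid K -> c.1 = d.1 -> act K c = act K d.
Proof. by case: K => [//|D b|a D] _ e; apply: diword_eqP; rewrite /= ?e. Qed.

Lemma act_id c : act (Mid [::] [::]) c = c.
Proof. by apply: diword_eqP; rewrite /= ?cats0. Qed.

Lemma diword_ex a l : (0 < l <= size a)%N -> exists2 D : diword X, a = D.1 & l = D.2.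
Proof. by move=> al; exists (Diword (a, l) al). Qed.

(* The context that surrounds a word of length n by a and b, so that the center of the
   product is at position l; the center comes from the argument when
   |a| < l <= |a| + n. *)
Definition ctx_of a b l n : ctx :=
  if insub (a, l) is Some D then Left D b
  else if insub (b, l - (size a + n))%N is Some D then Right a D else Mid a b.

Variant ctx_of_spec a b l n : ctx -> Prop :=
| CtxLeft D of a = D.1 & l = D.2 : ctx_of_spec a b l n (Left D b)
| CtxRight D of b = D.1 & l = (size a + n + D.2)%N : ctx_of_spec a b l n (Right a D)
| CtxMid of (size a < l <= size a + n)%N : ctx_of_spec a b l n (Mid a b).

Lemma ctx_ofP a b l n : (0 < l <= size a + n + size b)%N ->
  ctx_of_spec a b l n (ctx_of a b l n).
Proof.
move=> lab; rewrite /ctx_of; case: insubP => [D _ eD|/= nl].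
  by have -> : a = D.1; [rewrite eD | constructor; rewrite ?eD].
case: insubP => [D _ eD|/= nr]; last by constructor; lia.
by constructor; rewrite eD //=; have := diword_pos D; rewrite eD /=; lia.
Qed.

Lemma ctx_ofL D b n : ctx_of D.1 b D.2 n = Left D b.
Proof.
rewrite /ctx_of; case: insubP => [D' _ e|/=]; last by rewrite diword_pos.
by congr Left; apply: val_inj; rewrite /= e; case: (D : _ * _).
Qed.

Lemma ctx_ofR a D n : ctx_of a D.1 (size a + n + D.2) n = Right a D.
Proof.
have /andP[D0 D1] := diword_pos D; rewrite /ctx_of.
case: insubP => [D' /=|_]; first by lia.
have -> : (size a + n + D.2 - (size a + n) = D.2)%N by lia.
case: insubP => [D' _ e|/=]; last by rewrite D0 D1.
by congr Right; apply: val_inj; rewrite /= e; case: (D : _ * _).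
Qed.

Lemma ctx_ofM a b l n : (size a < l <= size a + n)%N -> ctx_of a b l n = Mid a b.
Proof.
move=> lan; rewrite /ctx_of; case: insubP => [D' /=|_]; first by lia.
by case: insubP => [D' /=|//]; lia.
Qed.

Lemma lw_ctx_of a b l n : lw (ctx_of a b l n) = a.
Proof.
rewrite /ctx_of; case: insubP => [D _ /= ->//|_].
by case: insubP.
Qed.

Lemma rw_ctx_of a b l n : rw (ctx_of a b l n) = b.
Proof.
rewrite /ctx_of; case: insubP => [D _ /= //|_].
by case: insubP => [D _ /= ->|].
Qed.

Lemma act_ctx_of a b l c : (0 < l <= size a + size c.1 + size b)%N ->
  ~~ (size a < l <= size a + size c.1)%N || (l == size a + c.2)%N ->
  (act (ctx_of a b l (size c.1)) c).2 = l.
Proof.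
move=> lab; case: (ctx_ofP lab) => [D _ ->|D _ -> _|lan]; rewrite /= ?size_cat //.
by rewrite lan => /eqP ->.
Qed.

(** A context is determined by its two words and the resulting center, once the length of the inner
    word is known. *)
Lemma ctx_of_act K c : ctx_of (lw K) (rw K) (act K c).2 (size c.1) = K.
Proof.
case: K => [a b|D b|a D] /=; last by rewrite size_cat ctx_ofR.
- by apply: ctx_ofM; have := diword_pos c; lia.
- exact: ctx_ofL.
Qed.

(** The inner word with [a] and [b] forms a block surrounded by [a0] and [b0]. If the center falls
    in the block, [l'] must account for it; otherwise the outer context forgets the inner center and
    [l'] is free. *)
Lemma comp_ctx_of a0 b0 a b l l' n : (0 < l <= size a0 + size a + n + size b + size b0)%N ->
  ((size a0 < l <= size a0 + (size a + n + size b))%N -> l = (size a0 + l')%N) ->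
  ccomp (ctx_of a0 b0 l (size a + n + size b)) (ctx_of a b l' n) =
  ctx_of (a0 ++ a) (b ++ b0) l n.
Proof.
move=> lt ll'; case: ctx_ofP; first by lia.
- move=> D ea el; rewrite /= lw_ctx_of rw_ctx_of ea el; exact/esym/(ctx_ofL (rcat D a)).
- move=> D eb el; rewrite /= lw_ctx_of rw_ctx_of eb.
  rewrite -(ctx_ofR _ (lcat b D) n) /= size_cat el; congr (ctx_of _ _ _ _); lia.
move=> lin; case: ctx_ofP.
- by have := ll' lin; lia.
- move=> D ea el /=; rewrite ea -(ctx_ofL (lcat a0 D) (b ++ b0) n) /= -el.
  by congr (ctx_of _ _ _ _); rewrite ll'.
- move=> D eb el /=; rewrite eb -(ctx_ofR (a0 ++ a) (rcat D b0) n) /= size_cat.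
  by congr (ctx_of _ _ _ _); rewrite ll' //; lia.
- by move=> lin' /=; rewrite ctx_ofM // size_cat; have := ll' lin; lia.
Qed.

(** * Monotonicity of contexts *)

Section Order.
Variable leW : rel (seq X).
Hypothesis leW_monomial : monomial_order leW.

Lemma act_ltW K c d : ltW leW c.1 d.1 -> ltW leW (act K c).1 (act K d).1.
Proof. by rewrite !act_word => cd; apply: ltW_cat => //; exact: diword_neq0. Qed.

Lemma act_lt K c d : is_mid K -> ltD leW c d -> ltD leW (act K c) (act K d).
Proof.
case: K => // a b _ /orP[/(act_ltW (Mid a b)) cd|/andP[/eqP e cd]].
  by rewrite /ltD cd.
by rewrite /ltD !act_word e eqxx /= ltn_add2l cd orbT.
Qed.

(** Only the weak inequality survives in general, since a context that forgets the center identifies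
    diwords on the same word. *)
Lemma act_le K c d : leD leW c d -> leD leW (act K c) (act K d).
Proof.
have [mK|nK] := boolP (is_mid K).
  by case/leDP => [->|/(act_lt mK)/ltDW//]; exact: leD_refl.
case/leDP => [->|/orP[/(act_ltW K) cd|/andP[/eqP cd _]]]; first exact: leD_refl.
  by apply: ltDW; rewrite /ltD cd.
by rewrite (act_collapse nK cd) leD_refl.
Qed.

End Order.
End Contexts.

(** * Normal diwords as images under contexts *)

Section NormalDiwords.
Variables (k : fieldType) (X : choiceType) (leW : rel (seq X)).
Hypothesis leW_monomial : monomial_order leW.
Implicit Types (f g h s : Di k X) (c d : diword X) (K : ctx X).

(** The condition that l belongs to P([asb]), in terms of contexts: a center outside s demands that
    s be strong. *)
Definition ok K s : bool := is_mid K || strong leW s.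

Lemma act_normal_lt K s c d : mlead leW s c -> ok K s -> d \in msupp s -> d != c ->
  ltD leW (act K d) (act K c).
Proof.
move=> ms /orP[mK|st] ds dc; first by apply: act_lt => //; have [_ ->] := ms.
by rewrite /ltD act_ltW //; move/(strongP leW_monomial ms): st; apply.
Qed.

(** Every other diword of the support is mapped strictly below [act K c], so nothing can cancel or
    alter the leading coefficient. *)
Lemma mlead_dlift K s c : mlead leW s c -> ok K s ->
  mlead leW (dlift (act K) s) (act K c).
Proof.
move=> ms okK; have lt d := @act_normal_lt K s c d ms okK.
split=> [|_ /msupp_dlift[d ds ->] ne]; last first.
  by apply: lt => //; apply: contra_neq ne => ->.
rewrite mcoeff_dlift (big_fsetD1 c) ?(mlead_supp ms) //= eqxx mulr1n.
have [-> _] := ms; rewrite big1_fset ?addr0 // => d.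
rewrite in_fsetD1 => /andP[dc ds] _.
by case: eqP (lt d ds dc) => // ->; rewrite ltD_irr.
Qed.

Lemma diwE (D : diword X) : diw k D.1 D.2 = << D >>.
Proof.
rewrite /diw; case: insubP => [D' _ e|/=]; last by rewrite diword_pos.
by congr << _ >>; apply: val_inj; rewrite /= e; case: (D : _ * _).
Qed.

Lemma diw_dashv (D : diword X) f : diw k D.1 D.2 ⊣ f = dlift (act (Left D [::])) f.
Proof.
rewrite diwE dashv_diwl; apply: eq_dlift => d.
by apply: diword_eqP; rewrite /= ?cats0.
Qed.

Lemma vdash_diw (D : diword X) f : f ⊢ diw k D.1 D.2 = dlift (act (Right [::] D)) f.
Proof. by rewrite diwE vdash_diwr; apply: eq_dlift => d; apply: diword_eqP. Qed.

Lemma lmul_dashv (D : diword X) f :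
  lmul (@dashv k X) D.1 D.2 f = dlift (act (Left D [::])) f.
Proof. by rewrite -diw_dashv; have := diword_neq0 D; case: D.1. Qed.

Lemma lmul_vdash a f : lmul (@vdash k X) a (size a) f = dlift (act (Mid a [::])) f.
Proof.
have [->|a0] := eqVneq a [::].
  by rewrite -[LHS]dlift_id; apply: eq_dlift => c; rewrite act_id.
have [|D ea el] := @diword_ex X a (size a); first by case: a a0 => //= x a _; lia.
have -> : lmul (@vdash k X) a (size a) f = diw k a (size a) ⊢ f by case: a a0 {ea el}.
rewrite [X in diw k X]ea el diwE vdash_diwl; apply: eq_dlift => d.
by apply: diword_eqP; rewrite /= ?cats0 ?ea.
Qed.

Lemma rmul_dashv b f : rmul (@dashv k X) f b 1 = dlift (act (Mid [::] b)) f.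
Proof.
have [->|b0] := eqVneq b [::].
  by rewrite -[LHS]dlift_id; apply: eq_dlift => c; rewrite act_id.
have [|D eb el] := @diword_ex X b 1; first by case: b b0.
have -> : rmul (@dashv k X) f b 1 = f ⊣ diw k b 1 by case: b b0 {eb}.
rewrite [X in diw k X]eb el diwE dashv_diwr; apply: eq_dlift => d.
by apply: diword_eqP; rewrite /= ?eb.
Qed.

Lemma rmul_vdash (D : diword X) f :
  rmul (@vdash k X) f D.1 D.2 = dlift (act (Right [::] D)) f.
Proof. by rewrite -vdash_diw; have := diword_neq0 D; case: D.1. Qed.

Lemma inP_bound s c a b l : mlead leW s c -> inP leW s a b l ->
  (0 < l <= size a + size c.1 + size b)%N.
Proof.
move=> ms; rewrite /inP (mlead_lword leW_monomial ms) (mlead_lpos leW_monomial ms) !size_cat.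
by have := diword_pos c; lia.
Qed.

(* The dictionary between normal s-diwords [a s b]_l and contexts. *)
Lemma ndiwE s c a b l : mlead leW s c -> inP leW s a b l ->
  ndiw leW s a b l = dlift (act (ctx_of a b l (size c.1))) s.
Proof.
move=> ms Pl; have lb := inP_bound ms Pl.
rewrite /ndiw (mlead_lpos leW_monomial ms) (mlead_lword leW_monomial ms) size_cat.
have := diword_pos c => cpos.
case: (ctx_ofP lb) => [D ea el|D eb el|lan].
- have := diword_pos D; rewrite ea el => /andP[_ ->].
  rewrite rmul_dashv lmul_dashv dlift_comp; apply: eq_dlift => d /=.
  by apply: diword_eqP; rewrite /= ?cats0 ?catA.
- have := diword_pos D => Dpos.
  rewrite ifF; last by lia.
  rewrite ifF; last by lia.
  have -> : (l - (size a + size c.1) = D.2)%N by lia.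
  rewrite eb rmul_vdash lmul_vdash dlift_comp; apply: eq_dlift => d /=.
  by apply: diword_eqP; rewrite /= ?cats0 ?size_cat.
- rewrite ifF; last by lia.
  have -> : (l == size a + c.2)%N.
    move: Pl; rewrite /inP (mlead_lword leW_monomial ms).
    by rewrite (mlead_lpos leW_monomial ms) !size_cat; lia.
  rewrite rmul_dashv lmul_vdash dlift_comp; apply: eq_dlift => d /=.
  by apply: diword_eqP; rewrite /= ?cats0 ?catA.
Qed.

Lemma inP_ok s c a b l : mlead leW s c -> inP leW s a b l ->
  ok (ctx_of a b l (size c.1)) s.
Proof.
move=> ms Pl; have lb := inP_bound ms Pl.
have cpos := diword_pos c; rewrite /ok.
move: Pl; rewrite /inP (mlead_lword leW_monomial ms) (mlead_lpos leW_monomial ms) !size_cat.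
case: (ctx_ofP lb) => [D -> ->|D -> ->|//] /=; have := diword_pos D; lia.
Qed.

Lemma inP_act s c a b l : mlead leW s c -> inP leW s a b l ->
  (act (ctx_of a b l (size c.1)) c).2 = l.
Proof.
move=> ms Pl; apply: act_ctx_of; first exact: inP_bound Pl.
by move: Pl; rewrite /inP (mlead_lword leW_monomial ms) (mlead_lpos leW_monomial ms) !size_cat; lia.
Qed.

Lemma ok_inP K s c : mlead leW s c -> ok K s -> inP leW s (lw K) (rw K) (act K c).2.
Proof.
move=> ms; rewrite /ok /inP (mlead_lword leW_monomial ms) (mlead_lpos leW_monomial ms) !size_cat.
have := diword_pos c.
case: K => [a b|D b|a D] /= cpos; rewrite ?eqxx //= => ->.
- by rewrite diword_pos orbT.
- by have := diword_pos D; rewrite size_cat; lia.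
Qed.

Lemma ok_ndiwE K s c : mlead leW s c -> ok K s ->
  ndiw leW s (lw K) (rw K) (act K c).2 = dlift (act K) s.
Proof. by move=> ms okK; rewrite (ndiwE ms) ?ctx_of_act //; exact: ok_inP. Qed.

End NormalDiwords.

(** * Combinations of normal S-diwords *)

Section NormalSpan.
Variables (k : fieldType) (X : choiceType) (leW : rel (seq X)).
Hypothesis leW_monomial : monomial_order leW.
Variable S : set (Di k X).
Hypothesis S_monic : forall s, S s -> Defs.monic leW s.
Implicit Types (f g h s : Di k X) (c d e : diword X) (K : ctx X).
Implicit Types (P Q : diword X -> Prop).

(** [act K c] is the leading diword of the generator, so [P] is a restriction on leading diwords,
    usually an upper bound. *)
Definition normal_gen P : set (Di k X) :=
  [set g | exists K s c, [/\ S s, mlead leW s c, ok leW K s, P (act K c)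
                           & g = dlift (act K) s]].

Definition nspan P : set (Di k X) := lspan (normal_gen P).

Lemma nspan_mono P Q f : (forall d, P d -> Q d) -> nspan P f -> nspan Q f.
Proof.
move=> PQ; apply: lspan_mono => _ [K [s [c [Ss ms okK Pc ->]]]].
by exists K, s, c; split=> //; apply: PQ.
Qed.

Lemma nspan_act K P Q f :
  (forall K' s c, S s -> mlead leW s c -> ok leW K' s -> P (act K' c) ->
    nspan Q (dlift (act (ccomp K K')) s)) ->
  nspan P f -> nspan Q (dlift (act K) f).
Proof.
move=> PQ; apply: lspan_dlift => _ [K' [s [c [Ss ms okK Pc ->]]]].
rewrite dlift_comp; have -> : act K \o act K' = act (ccomp K K').
  by apply/funext => d; rewrite act_comp.
exact: PQ ms okK Pc.
Qed.

Lemma nspan_gen K s c P : S s -> mlead leW s c -> ok leW K s -> P (act K c) ->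
  nspan P (dlift (act K) s).
Proof. by move=> Ss ms okK Pc; apply: lspan_in; exists K, s, c. Qed.

Lemma ok_comp_mid K K' s : is_mid K -> ok leW K' s -> ok leW (ccomp K K') s.
Proof. by move=> mK; rewrite /ok is_mid_comp mK. Qed.

Lemma nspan_mid K P Q f : is_mid K -> (forall d, P d -> Q (act K d)) ->
  nspan P f -> nspan Q (dlift (act K) f).
Proof.
move=> mK PQ; apply: nspan_act => K' s c Ss ms okK Pc.
by apply: nspan_gen ms _ _ => //; [exact: ok_comp_mid | rewrite act_comp; apply: PQ].
Qed.

Lemma trivial_nspan P h : trivial_mod leW S h ->
  (forall d e, e \in msupp h -> leD leW d e -> P d) -> nspan P h.
Proof.
case=> n [alpha [s [a [b [m [gen eh]]]]]] hP; rewrite eh.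
apply: lspan_sum => i _; apply: lspanZ; have [Ss Pi le] := gen i.
have /(dmonicP leW_monomial)[c mc] := S_monic Ss.
rewrite (ndiwE leW_monomial mc Pi) in le *.
have okK := inP_ok leW_monomial mc Pi.
have mK := mlead_lead leW_monomial (mlead_dlift leW_monomial mc okK).
apply: nspan_gen mc okK _ => //.
move: le; rewrite mK.
(* For a zero [h] the bound by [None] excludes every generator. *)
case lh: (lead leW _) => [e|] //= le.
have [e_h _] := lead_max leW_monomial lh.
exact: hP e_h le.
Qed.

Lemma nspan_trivial h : nspan (fun d => leD0 leW (Some d) (lead leW h)) h ->
  trivial_mod leW S h.
Proof.
(* The bound is frozen as [t], since the induction runs through partial sums with other leading
   diwords. *)
rewrite /trivial_mod; move: (lead leW h) => t.
elim=> [|x _ f [K [s [c [Ss ms okK Pc ->]]]] _ [n [al [s' [a [b [m [gen ->]]]]]]]].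
  exists 0%N, (fun=> 0), (fun=> 0), (fun=> [::]), (fun=> [::]), (fun=> 0%N).
  by split; [case | rewrite big_ord0].
pose ext U (u0 : U) (u : 'I_n -> U) (i : 'I_n.+1) := oapp u u0 (unlift ord0 i).
exists n.+1, (ext _ x al), (ext _ s s'), (ext _ (lw K) a), (ext _ (rw K) b),
  (ext _ (act K c).2 m).
split=> [i|]; last first.
  rewrite big_ord_recl /ext unlift_none /= (ok_ndiwE leW_monomial ms okK).
  by under [in RHS]eq_bigr do rewrite liftK.
rewrite /ext; case: unliftP => [j _|_] /=; first exact: gen.
split=> //; first exact: (ok_inP leW_monomial).
rewrite (ok_ndiwE leW_monomial ms okK).
by rewrite (mlead_lead leW_monomial (mlead_dlift leW_monomial ms okK)).
Qed.

Hypothesis S_trivial : forall h, composition leW S h -> trivial_mod leW S h.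

Lemma dlift_act_bound K s c e : mlead leW s c ->
  e \in msupp (dlift (act K) s) -> leD leW e (act K c).
Proof.
move=> [_ cmax] /msupp_dlift[d ds ->]; apply: act_le => //.
have [->|ne] := eqVneq d c; first exact: leD_refl.
exact/ltDW/cmax.
Qed.

Lemma nspan_collapse K h s c : h = dlift (act K) s -> S s -> mlead leW s c ->
  composition leW S h -> nspan (fun d => leD leW d (act K c)) h.
Proof.
move=> eh Ss ms /S_trivial/trivial_nspan; apply=> d e.
by rewrite eh => /(dlift_act_bound ms) ec de; apply: leD_trans ec.
Qed.

(* The value [leD d (act K c)] is preserved although [act K] is only weakly
   monotone; a non-strong [s] under a collapsing context is rewritten by the
   multiplication compositions, one letter at a time on the left. *)
Lemma nspan_act_gen K s c : S s -> mlead leW s c ->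
  nspan (fun d => leD leW d (act K c)) (dlift (act K) s).
Proof.
move: {2}(act K c) (erefl (act K c)) => t.
elim/(well_founded_ind (ltD_wf leW_monomial)): t K s c => t ih K s c et Ss ms.
have [okK|] := boolP (ok leW K s); first by apply: nspan_gen ms okK _ => //; exact: leD_refl.
rewrite /ok negb_or => /andP[nK nst].
case: K nK et => [//|D b|a D] _ et.
(* The letter of [D.1] adjacent to [s] is the last one; it enters the left multiplication
   composition. *)
- have [u [x eD]] : exists u x, D.1 = rcons u x.
    by case/lastP: (D.1) (diword_neq0 D) => // u x _; exists u, x.
  have [x1 e1 e2] := @diword_ex X [:: x] 1 isT.
  have hx : nspan (fun d => leD leW d (act (Left x1 [::]) c)) (dlift (act (Left x1 [::])) s).
    have ex : diw k [:: x] 1 ⊣ s = dlift (act (Left x1 [::])) s.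
      by rewrite e1 [X in diw k _ X]e2 diw_dashv.
    by rewrite -ex; apply: nspan_collapse ms _ => //; apply: LeftMul.
  have [Du|uD] := leqP D.2 (size u).
    have [|D' f1 f2] := @diword_ex X u D.2; first by have := diword_pos D; lia.
    have eK : Left D b = ccomp (Left D' b) (Left x1 [::]).
      by congr Left; apply: diword_eqP; rewrite /= -?f1 -?f2 -?e1 ?cats1 -?eD.
    have -> : dlift (act (Left D b)) s = dlift (act (Left D' b)) (dlift (act (Left x1 [::])) s).
      by rewrite dlift_comp; apply: eq_dlift => d; rewrite eK act_comp.
    apply: nspan_act hx => K' s' c' Ss' ms' okK' le'.
    have le : leD leW (act (ccomp (Left D' b) K') c') (act (Left D b) c).
      by rewrite eK !act_comp; apply: act_le.
    have [okK|] := boolP (ok leW (ccomp (Left D' b) K') s').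
      exact: nspan_gen ms' okK _.
    (* A bad generator is a non-strong [s'] under a context [K'] that keeps the center. The
       induction applies once the word of [act K' c'] is strictly below that of [act (Left x1 [::])
       c]. *)
    rewrite /ok /= => nst'; move: okK'; rewrite /ok (negbTE nst') orbF => mK'.
    apply: nspan_mono (ih _ _ _ _ _ erefl Ss' ms') => [d dle|].
      exact: leD_trans le.
    rewrite -et eK !(act_comp (Left D' b)) /ltD act_ltW //.
    case/leDP: le' => [e'|/orP[//|/andP[_ lt1]]].
      (* Equality puts the center of [act K' c'] at 1 and forces [c'.2] to be 1, while failure of
         strength demands a diword on the same word with a smaller center. *)
      move: nst'; case/(strongP leW_monomial ms') => d ds' ne.
      have [_ /(_ d ds' ne)/orP[//|/andP[_]]] := ms'.
      have := diword_pos d; case: (K') mK' e' => // a' b' _ /(congr1 (fun c => c.2)) /=.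
      by rewrite -e2; lia.
    move: lt1 => /=; rewrite -e2.
    by have := diword_pos (act K' c'); lia.
  (* With the center on [x], the outer context keeps the center, so normal diwords stay normal. *)
  have eK : Left D b = ccomp (Mid u b) (Left x1 [::]).
    congr Left; apply: diword_eqP; rewrite /= -?e1 ?cats1 -?eD //.
    by have := diword_pos D; rewrite eD size_rcons -e2; lia.
  have -> : dlift (act (Left D b)) s = dlift (act (Mid u b)) (dlift (act (Left x1 [::])) s).
    by rewrite dlift_comp; apply: eq_dlift => d; rewrite eK act_comp.
  by apply: nspan_mid hx => // d dle; rewrite eK act_comp; apply: act_le.
- have Dpos := diword_pos D.
  have [|U e1 e2] := @diword_ex X (take D.2 D.1) D.2; first by rewrite size_takel; lia.
  have eK : Right a D = ccomp (Mid a (drop D.2 D.1)) (Right [::] U).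
    by rewrite /= cats0; congr Right; apply: diword_eqP; rewrite //= -e1 cat_take_drop.
  have hU : nspan (fun d => leD leW d (act (Right [::] U) c)) (dlift (act (Right [::] U)) s).
    have eU : s ⊢ diw k U.1 (size U.1) = dlift (act (Right [::] U)) s.
      by rewrite -vdash_diw -e2 -[in X in diw k _ X]e1 size_takel //; lia.
    by rewrite -eU; apply: nspan_collapse ms _ => //; apply: RightMul => //; exact: diword_neq0.
  have -> : dlift (act (Right a D)) s =
      dlift (act (Mid a (drop D.2 D.1))) (dlift (act (Right [::] U)) s).
    by rewrite dlift_comp; apply: eq_dlift => d; rewrite eK act_comp.
  by apply: nspan_mid hU => // d dle; rewrite eK act_comp; apply: act_le.
Qed.

Lemma nspan_dlift K P Q f : (forall c d, P c -> leD leW d (act K c) -> Q d) ->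
  nspan P f -> nspan Q (dlift (act K) f).
Proof.
move=> PQ; apply: nspan_act => K' s c Ss ms okK' Pc.
apply: nspan_mono (nspan_act_gen (ccomp K K') Ss ms) => d.
by rewrite act_comp; apply: PQ.
Qed.

Lemma nspan_ideal : is_ideal (nspan (fun=> True)).
Proof.
have cl K f : nspan (fun=> True) f -> nspan (fun=> True) (dlift (act K) f).
  by apply: nspan_dlift.
split=> [|a f g Nf Ng|f g Nf]; first exact: lspan0.
  by apply: lspanD => //; apply: lspanZ.
split.
- rewrite vdashE'; apply: lspan_sum => d _; apply: lspanZ.
  rewrite (@eq_dlift _ _ _ (act (Right [::] d))); [exact: cl | move=> c].
  exact: diword_eqP.
- rewrite vdashE; apply: lspan_sum => d _; apply: lspanZ.
  rewrite (@eq_dlift _ _ _ (act (Mid d.1 [::]))); [exact: cl | move=> c].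
  by apply: diword_eqP; rewrite /= ?cats0.
- rewrite dashvE'; apply: lspan_sum => d _; apply: lspanZ.
  rewrite (@eq_dlift _ _ _ (act (Mid [::] d.1))); [exact: cl | move=> c].
  exact: diword_eqP.
- rewrite dashvE; apply: lspan_sum => d _; apply: lspanZ.
  rewrite (@eq_dlift _ _ _ (act (Left d [::]))); [exact: cl | move=> c].
  by apply: diword_eqP; rewrite /= ?cats0.
Qed.

End NormalSpan.

(** * Normal S-diwords with the same leading diword *)

Lemma cat_split (T : Type) (u v u' v' : seq T) : u ++ v = u' ++ v' ->
  (size u <= size u')%N -> exists2 t, u' = u ++ t & v = t ++ v'.
Proof.
elim: u u' => [|x u ih] [|y u'] //=.
- by move=> ->; exists [::].
- by move=> ->; exists (y :: u').
- by case=> <- e /(ih _ e)[t -> ->]; exists t.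
Qed.

Lemma subr_exchange (V : zmodType) (A B Y Z : V) : A + Y = B + Z -> A - B = Z - Y.
Proof. by move=> e; rewrite -[A](addrK Y) e addrAC [B + Z]addrC addrK. Qed.

(** Each factor lies in the word surrounding the other: [F1 d] and [F2 c] are the given contexts
    with that factor replaced by [d] or [c]. Comparing centers eliminates four of the nine pairs of
    shapes. *)
Lemma disjoint_contexts (X : choiceType) (K1 K2 : ctx X) (c1 c2 : diword X) (e : seq X) :
  lw K2 = lw K1 ++ c1.1 ++ e -> rw K1 = e ++ c2.1 ++ rw K2 -> act K1 c1 = act K2 c2 ->
  exists F1 F2 : diword X -> ctx X,
    [/\ F1 c2 = K1, F2 c1 = K2, forall c d, act (F1 d) c = act (F2 c) d,
        forall d, is_mid (F1 d) = is_mid K1 & forall c, is_mid (F2 c) = is_mid K2].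
Proof.
have pc1 := diword_pos c1; have pc2 := diword_pos c2.
case: K1 K2 => [a1 b1|D1 b1|a1 D1] [a2 b2|D2 b2|a2 D2] /= el er
  /(congr1 (fun c : diword X => c.2)) /= ep.
- by move: ep; rewrite el !size_cat; lia.
- exists (fun d => Mid a1 (e ++ d.1 ++ b2)), (fun c => Left (lcat a1 (rcat c e)) b2).
  split=> // [|/=|c d]; first by rewrite er.
  + by congr Left; apply: diword_eqP.
  + by apply: diword_eqP; rewrite /= -?catA.
- by move: ep; rewrite el !size_cat; lia.
- by have := diword_pos D1; move: ep; rewrite el !size_cat; lia.
- exists (fun d => Left D1 (e ++ d.1 ++ b2)), (fun c => Left (rcat D1 (c.1 ++ e)) b2).
  split=> // [|/=|c d]; first by rewrite er.
  + by congr Left; apply: diword_eqP.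
  + by apply: diword_eqP; rewrite /= -?catA.
- by have := diword_pos D1; move: ep; rewrite el !size_cat; lia.
- exists (fun d => Right a1 (lcat e (rcat d b2))), (fun c => Mid (a1 ++ c.1 ++ e) b2).
  split=> // [|/=|c d].
  + congr Right; apply: diword_eqP => //=.
    by move: ep; rewrite el !size_cat; lia.
  + by rewrite el.
  + by apply: diword_eqP; rewrite /= -?catA // !size_cat; lia.
- have pD2 := diword_pos D2; have pD1 := diword_pos D1.
  (* The center lies in the gap [e] between the two factors. *)
  have [|E e1 e2] := @diword_ex X e D1.2.
    by move: pD2; rewrite el !size_cat -ep !size_cat; lia.
  exists (fun d => Right a1 (rcat E (d.1 ++ b2))), (fun c => Left (lcat (a1 ++ c.1) E) b2).
  split=> // [|/=|c d].
  + by congr Right; apply: diword_eqP; rewrite /= -?e1 // er.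
  + by congr Left; apply: diword_eqP; rewrite /= -?e1 -?e2 -?catA // size_cat.
  + by apply: diword_eqP; rewrite /= -?catA.
- exists (fun d => Right a1 (lcat (e ++ d.1) D2)), (fun c => Right (a1 ++ c.1 ++ e) D2).
  split=> // [|/=|c d].
  + congr Right; apply: diword_eqP; rewrite /= -?catA //.
    by move: ep; rewrite el !size_cat; lia.
  + by rewrite el.
  + by apply: diword_eqP; rewrite /= -?catA // !size_cat; lia.
Qed.

Section SameLead.
Variables (k : fieldType) (X : choiceType) (leW : rel (seq X)).
Hypothesis leW_monomial : monomial_order leW.
Variable S : set (Di k X).
Hypothesis S_monic : forall s, S s -> Defs.monic leW s.
Hypothesis S_trivial : forall h, composition leW S h -> trivial_mod leW S h.
Implicit Types (f g h s : Di k X) (c d e : diword X) (K : ctx X).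
Implicit Types (P Q : diword X -> Prop).

Local Notation nspan := (nspan leW S).
Local Notation ltD := (ltD leW).
Local Notation leD := (leD leW).
Local Notation inP := (inP leW).
Local Notation ndiw := (ndiw leW).

Lemma sum_mlead s c (F : diword X -> Di k X) : mlead leW s c ->
  \sum_(d <- msupp s) s@_d *: F d = F c + \sum_(d <- (msupp s `\ c)%fset) s@_d *: F d.
Proof.
by move=> ms; have [sc _] := ms; rewrite (big_fsetD1 c (mlead_supp ms)) /= sc scale1r.
Qed.

(** Inserting [s1] and [s2] at once gives one element, which expands along either support. Comparing
    the expansions trades the difference of the leading summands for the other summands, whose
    leading diwords are smaller. *)
Lemma nspan_disjoint (F1 F2 : diword X -> ctx X) s1 s2 c1 c2 :
  S s1 -> S s2 -> mlead leW s1 c1 -> mlead leW s2 c2 ->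
  (forall c d, act (F1 d) c = act (F2 c) d) ->
  (forall d, ok leW (F1 d) s1) -> (forall c, ok leW (F2 c) s2) ->
  nspan (fun d => ltD d (act (F1 c2) c1))
    (dlift (act (F1 c2)) s1 - dlift (act (F2 c1)) s2).
Proof.
move=> Ss1 Ss2 ms1 ms2 eF ok1 ok2.
have exch : \sum_(d <- msupp s2) s2@_d *: dlift (act (F1 d)) s1 =
            \sum_(c <- msupp s1) s1@_c *: dlift (act (F2 c)) s2.
  under eq_bigr do rewrite /dlift scaler_sumr.
  under [RHS]eq_bigr do rewrite /dlift scaler_sumr.
  rewrite exchange_big; apply: eq_bigr => c _; apply: eq_bigr => d _.
  by rewrite !scale_malgU mulrC eF.
rewrite (sum_mlead _ ms1) (sum_mlead _ ms2) in exch.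
set A := dlift _ s1 in exch *; set B := dlift _ s2 in exch *.
have -> : A - B = \sum_(c <- (msupp s1 `\ c1)%fset) s1@_c *: dlift (act (F2 c)) s2
  - \sum_(d <- (msupp s2 `\ c2)%fset) s2@_d *: dlift (act (F1 d)) s1.
  exact: subr_exchange exch.
apply: lspanB; apply: lspan_sum => d; rewrite in_fsetD1 => /andP[ne ds];
  apply: lspanZ; [apply: (nspan_gen Ss2 ms2 (ok2 d)) | apply: (nspan_gen Ss1 ms1 (ok1 d))].
- by rewrite -eF; apply: act_normal_lt ms1 _ _ _.
- by rewrite eF [act (F1 c2) c1]eF; apply: act_normal_lt ms2 _ _ _.
Qed.

(* Applying a context to a trivial composition keeps the terms below the common
   leading diword, even when the context is only weakly monotone. *)
Lemma nspan_composition K K1 K2 s1 s2 c1 c2 :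
  S s1 -> S s2 -> mlead leW s1 c1 -> mlead leW s2 c2 -> act K1 c1 = act K2 c2 ->
  ok leW K1 s1 -> ok leW K2 s2 ->
  ok leW (ccomp K K1) s1 -> ok leW (ccomp K K2) s2 ->
  trivial_mod leW S (dlift (act K1) s1 - dlift (act K2) s2) ->
  nspan (fun d => ltD d (act (ccomp K K1) c1))
    (dlift (act (ccomp K K1)) s1 - dlift (act (ccomp K K2)) s2).
Proof.
move=> Ss1 Ss2 ms1 ms2 eK ok1 ok2 okK1 okK2 tr.
have eD K' s : dlift (act (ccomp K K')) s = dlift (act K) (dlift (act K') s).
  by rewrite dlift_comp; apply: eq_dlift => d; rewrite act_comp.
rewrite !eD -linearB.
apply: (@nspan_dlift _ _ _ leW_monomial _ S_monic S_trivial _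
  (fun d => ltD (act K d) (act K (act K1 c1)))) => [c d lt le|].
  by rewrite act_comp; apply: leD_ltD_trans lt.
apply: trivial_nspan => // d e eh de; apply: (@leD_ltD_trans _ _ leW_monomial (act K e)).
  exact: act_le.
have [m1 m2] := (mlead_dlift leW_monomial ms1 ok1, mlead_dlift leW_monomial ms2 ok2).
have ne : e != act K1 c1.
  by apply: msuppB_neq eh; [case: m1 | rewrite eK; case: m2].
have := fsubsetP (msuppB_le _ _) e eh; rewrite inE => /orP[]/msupp_dlift[d' ds ed].
- rewrite ed -!act_comp; apply: act_normal_lt ms1 _ _ _ => //.
  by apply: contra_neq ne => <-.
- rewrite ed eK -!act_comp; apply: act_normal_lt ms2 _ _ _ => //.
  by apply: contra_neq ne => dc; rewrite ed eK dc.
Qed.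

Section Overlap.
Variables (s1 s2 : Di k X) (c1 c2 : diword X).
Hypotheses (Ss1 : S s1) (Ss2 : S s2) (ms1 : mlead leW s1 c1) (ms2 : mlead leW s2 c2).

(** Both normal diwords arise, under one outer context, from those on the common block
    [a1 ++ c1.1 ++ b1], whose difference is trivial. The block center [m] matters only if [l] falls
    in the block. *)
Lemma nspan_hull a0 b0 l a1 b1 a2 b2 m : a1 ++ c1.1 ++ b1 = a2 ++ c2.1 ++ b2 ->
  inP s1 (a0 ++ a1) (b1 ++ b0) l -> inP s2 (a0 ++ a2) (b2 ++ b0) l ->
  inP s1 a1 b1 m -> inP s2 a2 b2 m ->
  ((size a0 < l <= size a0 + (size a1 + size c1.1 + size b1))%N -> l = (size a0 + m)%N) ->
  trivial_mod leW S (ndiw s1 a1 b1 m - ndiw s2 a2 b2 m) ->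
  let K1 := ctx_of (a0 ++ a1) (b1 ++ b0) l (size c1.1) in
  let K2 := ctx_of (a0 ++ a2) (b2 ++ b0) l (size c2.1) in
  nspan (fun d => ltD d (act K1 c1)) (dlift (act K1) s1 - dlift (act K2) s2).
Proof.
move=> ew P1 P2 p1 p2 lm tr /=.
have [o1 o2] := (inP_ok leW_monomial ms1 P1, inP_ok leW_monomial ms2 P2).
have sz : (size a1 + size c1.1 + size b1 = size a2 + size c2.1 + size b2)%N.
  by have := congr1 size ew; rewrite !size_cat; lia.
have lb := inP_bound leW_monomial ms1 P1; rewrite !size_cat in lb.
have e1 := @comp_ctx_of _ a0 b0 a1 b1 l m (size c1.1) _ lm.
have e2 := @comp_ctx_of _ a0 b0 a2 b2 l m (size c2.1) _ _.
rewrite -sz in e2; rewrite -e1 -?e2 //; last by lia.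
rewrite -e1 in o1; last by lia.
rewrite -e2 // in o2; last by lia.
have [k1 k2] := (inP_ok leW_monomial ms1 p1, inP_ok leW_monomial ms2 p2).
rewrite (ndiwE leW_monomial ms1 p1) (ndiwE leW_monomial ms2 p2) in tr.
apply: (nspan_composition Ss1 Ss2 ms1 ms2 _ k1 k2 o1 o2 tr).
apply: diword_eqP; first by rewrite !act_word !lw_ctx_of !rw_ctx_of.
by rewrite (inP_act leW_monomial ms1 p1) (inP_act leW_monomial ms2 p2).
by lia.
Qed.

(** The triviality hypotheses stand for the ordinary, left and right multiplicative compositions.
    The block is extended by a letter on the side of the center only when it has no common
    center. *)
Lemma nspan_overlap a1 b1 a2 b2 : a1 ++ c1.1 ++ b1 = a2 ++ c2.1 ++ b2 ->
  (forall m, inP s1 a1 b1 m -> inP s2 a2 b2 m ->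
    trivial_mod leW S (ndiw s1 a1 b1 m - ndiw s2 a2 b2 m)) ->
  ((forall m, ~~ (inP s1 a1 b1 m && inP s2 a2 b2 m)) ->
     strong leW s1 -> strong leW s2 -> forall x,
     trivial_mod leW S (ndiw s1 (x :: a1) b1 1 - ndiw s2 (x :: a2) b2 1)) ->
  (let L := (size a1 + size c1.1 + size b1).+1 in
   (forall m, ~~ (inP s1 a1 b1 m && inP s2 a2 b2 m)) ->
     strong leW s1 -> strong leW s2 -> forall x,
     trivial_mod leW S (ndiw s1 a1 (rcons b1 x) L - ndiw s2 a2 (rcons b2 x) L)) ->
  forall a0 b0 l, inP s1 (a0 ++ a1) (b1 ++ b0) l -> inP s2 (a0 ++ a2) (b2 ++ b0) l ->
  let K1 := ctx_of (a0 ++ a1) (b1 ++ b0) l (size c1.1) in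
  let K2 := ctx_of (a0 ++ a2) (b2 ++ b0) l (size c2.1) in
  nspan (fun d => ltD d (act K1 c1)) (dlift (act K1) s1 - dlift (act K2) s2).
Proof.
move=> ew hI hL hR a0 b0 l P1 P2.
have sz : (size a1 + size c1.1 + size b1 = size a2 + size c2.1 + size b2)%N.
  by have := congr1 size ew; rewrite !size_cat; lia.
have lb := inP_bound leW_monomial ms1 P1; rewrite !size_cat in lb.
have pc1 := diword_pos c1; have pc2 := diword_pos c2.
have inPE s c a b m : mlead leW s c -> inP s a b m =
    (m == size a + c.2)%N || strong leW s && ((0 < m <= size a) ||
      (size a + size c.1 < m <= size a + (size c.1 + size b)))%N.
  by move=> ms; rewrite /Defs.inP (mlead_lword leW_monomial ms)
    (mlead_lpos leW_monomial ms) !size_cat.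
have [lin|lout] := boolP (size a0 < l <= size a0 + (size a1 + size c1.1 + size b1))%N.
  have p1 : inP s1 a1 b1 (l - size a0).
    by move: P1; rewrite !(inPE _ c1) // !size_cat; case: (strong _ _) => //=; lia.
  have p2 : inP s2 a2 b2 (l - size a0).
    by move: P2; rewrite !(inPE _ c2) // !size_cat; case: (strong _ _) => //=; lia.
  by apply: (nspan_hull ew P1 P2 p1 p2 _ (hI _ p1 p2)); lia.
(* A center outside the block lies in neither factor, so both elements must be strong. *)
have st1 : strong leW s1.
  by move: P1; rewrite !(inPE _ c1) // !size_cat; case: (strong _ _) => //=; lia.
have st2 : strong leW s2.
  by move: P2; rewrite !(inPE _ c2) // !size_cat; case: (strong _ _) => //=; lia.
(* Any common center of the block serves, since the outer context forgets it. *)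
have [[m /andP[p1 p2]]|nex] := pselect (exists m, inP s1 a1 b1 m && inP s2 a2 b2 m).
  by apply: (nspan_hull ew P1 P2 p1 p2 _ (hI _ p1 p2)); rewrite (negbTE lout).
have nP m : ~~ (inP s1 a1 b1 m && inP s2 a2 b2 m).
  by apply/negP => p; apply: nex; exists m.
have [la|al] := leqP l (size a0).
  (* The last letter of [a0] joins the block and carries center 1 of the composition; if [l] lies in
     the enlarged block, it is exactly there. *)
  case/lastP: a0 P1 P2 la lb {lout} => [|a0 x]; first by move=> _ _ /=; lia.
  rewrite !cat_rcons size_rcons => P1 P2 la lb.
  have p1 : inP s1 (x :: a1) b1 1 by rewrite (inPE _ c1) // st1 orbT.
  have p2 : inP s2 (x :: a2) b2 1 by rewrite (inPE _ c2) // st2 orbT.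
  apply: (nspan_hull _ P1 P2 p1 p2 _ (hL nP st1 st2 x)); first by rewrite /= ew.
  by lia.
(* Symmetrically, the first letter of [b0] joins the block and carries its last position. *)
case: b0 P1 P2 lb lout => [|x b0]; first by move=> _ _ /=; lia.
rewrite -!cat_rcons /= => P1 P2 lb lout.
have p1 : inP s1 a1 (rcons b1 x) (size a1 + size c1.1 + size b1).+1.
  by rewrite (inPE _ c1) // st1 size_rcons /=; lia.
have p2 : inP s2 a2 (rcons b2 x) (size a1 + size c1.1 + size b1).+1.
  by rewrite (inPE _ c2) // st2 size_rcons /=; lia.
apply: (nspan_hull _ P1 P2 p1 p2 _ (hR nP st1 st2 x)).
  by rewrite -!cats1 (catA c1.1) (catA a1) ew -!catA.
by rewrite size_rcons; lia.
Qed.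

End Overlap.

Lemma nspan_same_lead K1 K2 s1 s2 c1 c2 :
  S s1 -> S s2 -> mlead leW s1 c1 -> mlead leW s2 c2 ->
  ok leW K1 s1 -> ok leW K2 s2 -> act K1 c1 = act K2 c2 ->
  nspan (fun d => ltD d (act K1 c1)) (dlift (act K1) s1 - dlift (act K2) s2).
Proof.
wlog le12 : K1 K2 s1 s2 c1 c2 / (size (lw K1) <= size (lw K2))%N.
  move=> W Ss1 Ss2 ms1 ms2 ok1 ok2 eK.
  have [le|/ltnW le] := leqP (size (lw K1)) (size (lw K2)).
    exact: (W _ _ _ _ _ _ le Ss1 Ss2 ms1 ms2 ok1 ok2 eK).
  rewrite -opprB -scaleN1r eK; apply: lspanZ.
  exact: (W _ _ _ _ _ _ le Ss2 Ss1 ms2 ms1 ok2 ok1 (esym eK)).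
move=> Ss1 Ss2 ms1 ms2 ok1 ok2 eK.
have ew := congr1 (fun c : diword X => c.1) eK; rewrite /= !act_word in ew.
have [P1 P2] := (ok_inP leW_monomial ms1 ok1, ok_inP leW_monomial ms2 ok2).
have [E1 E2] := (ctx_of_act K1 c1, ctx_of_act K2 c2).
(* Each context is now given by its surrounding words and the common center [l], the form used in
   [nspan_overlap]. *)
rewrite -eK in P2 E2; move: (act K1 c1).2 P1 P2 E1 E2 => l P1 P2 E1 E2.
(* [t] separates the starting points of the two factors; they are disjoint when it is at least as
   long as [c1.1]. *)
have [t et ew1] := cat_split ew le12.
have [tl|lt] := leqP (size c1.1) (size t).
  have [e ee ew2] := cat_split ew1 tl; rewrite ee in et.
  have [F1 [F2 [f1 f2 eF m1 m2]]] := disjoint_contexts et ew2 eK; rewrite -f1 -f2.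
  apply: nspan_disjoint => //.
  - by move=> d; rewrite /ok m1.
  - by move=> c; rewrite /ok m2.
have ew1' : t ++ (c2.1 ++ rw K2) = c1.1 ++ rw K1 by [].
have [b eb ew2] := cat_split ew1' (ltnW lt).
have [le|/ltnW le] := leqP (size c2.1) (size b).
  have [b' eb' er] := cat_split ew2 le; rewrite {}eb' {ew1 ew1' ew2 le} in eb.
  have := @nspan_overlap s1 s2 c1 c2 Ss1 Ss2 ms1 ms2 [::] [::] t b'.
  rewrite /= cats0 => /(_ eb).
  have nd1 : ndiw s1 [::] [::] (lpos leW s1) = s1.
    rewrite /Defs.ndiw /= eqxx (mlead_lpos leW_monomial ms1).
    by have := diword_pos c1; case: c1.2.
  have lw1 := mlead_lword leW_monomial ms1; have lw2 := mlead_lword leW_monomial ms2.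
  have in1 : inP s1 [::] [::] (lpos leW s1) by rewrite /Defs.inP eqxx.
  have ewl : lword leW s1 = t ++ lword leW s2 ++ b' by rewrite lw1 lw2.
  move=> /(_ _ _ _ (lw K1) (rw K1) l); rewrite cats0 -et -er E1 E2; apply=> //.
  - move=> m; rewrite {1}/Defs.inP /= => p1 p2.
    (* With both surrounding words empty, the only admissible center is that of [s1] itself. *)
    have em : m = lpos leW s1 by move: p1; case: (strong _ _) => /=; rewrite ?cats0; lia.
    rewrite em nd1; apply: S_trivial; apply: Inclusion => //.
    by rewrite -em.
  - move=> /(_ (lpos leW s1)); rewrite in1 /= => np st1 st2 x.
    by apply: S_trivial; apply: LeftMulInclusion.
  - move=> /(_ (lpos leW s1)); rewrite in1 /= => np st1 st2 x.
    rewrite addn0 -lw1; apply: S_trivial; exact: RightMulInclusion.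
(* Here [t] may be empty: [c1.1] as a proper prefix of [c2.1] counts as an intersection. *)
have [b' eb' er] := cat_split (esym ew2) le.
have ewo : c1.1 ++ b' = t ++ c2.1 by rewrite eb eb' -catA.
have := @nspan_overlap s1 s2 c1 c2 Ss1 Ss2 ms1 ms2 [::] b' t [::].
rewrite /= cats0 => /(_ ewo).
have lw1 := mlead_lword leW_monomial ms1; have lw2 := mlead_lword leW_monomial ms2.
have ewl : lword leW s1 ++ b' = t ++ lword leW s2 by rewrite lw1 lw2.
have lts : (size (lword leW s1 ++ b') < size (lword leW s1) + size (lword leW s2))%N.
  by have := congr1 size ewo; rewrite lw1 lw2 !size_cat; lia.
move=> /(_ _ _ _ (lw K1) (rw K2) l); rewrite cats0 -et -er E1 E2; apply=> //.
- by move=> m p1 p2; apply: S_trivial; apply: Intersection.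
- by move=> np st1 st2 x; apply: S_trivial; apply: LeftMulIntersection.
- move=> np st1 st2 x; rewrite add0n -lw1 -size_cat; apply: S_trivial.
  exact: RightMulIntersection.
Qed.

End SameLead.

(** * Composition-Diamond lemma *)

Section CompositionDiamond.
Variables (k : fieldType) (X : choiceType) (leW : rel (seq X)).
Hypothesis leW_monomial : monomial_order leW.
Implicit Types (f g h s : Di k X) (c d e : diword X) (K : ctx X).
Implicit Types (P Q : diword X -> Prop) (I S : set (Di k X)).

Local Notation lead := (lead leW).
Local Notation ltD := (ltD leW).
Local Notation leD := (leD leW).
Local Notation mlead := (mlead leW).

Definition covered_by s c : Prop :=
  exists K d, [/\ mlead s d, ok leW K s & act K d = c].

Lemma IrrP S c : (forall s, S s -> Defs.monic leW s) ->
  Irr leW S c <-> ~ exists2 s, S s & covered_by s c.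
Proof.
move=> Sm; split=> nex.
  move=> [s Ss [K [d [ms okK ec]]]]; apply: nex.
  exists s, (lw K), (rw K), (act K d).2; split=> //; first exact: ok_inP.
  rewrite (ok_ndiwE leW_monomial ms okK) -ec.
  exact/mlead_lead/mlead_dlift.
move=> [s [a [b [l [Ss Pl]]]]]; have /(dmonicP leW_monomial)[d ms] := Sm s Ss.
have okK := inP_ok leW_monomial ms Pl.
rewrite (ndiwE leW_monomial ms Pl) (mlead_lead leW_monomial (mlead_dlift leW_monomial ms okK)).
by case=> ec; apply: nex; exists s => //; exists (ctx_of a b l (size d.1)), d.
Qed.

(** If surrounding a word by fixed words made it smaller, repeating this would give an infinite
    descent. *)
Lemma act_ge K c : leD c (act K c).
Proof.
have [nil|] := eqVneq (lw K ++ rw K) [::].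
  case: K nil => [[|//] [|//] _|D b|a D].
  - by rewrite act_id leD_refl.
  - by rewrite /=; have := diword_neq0 D; case: (D.1).
  - by rewrite /=; have := diword_neq0 D; case: a; case: (D.1).
move=> nnil; apply: nltD => //; rewrite /ltD act_word.
have ne : (lw K ++ c.1 ++ rw K == c.1) = false.
  apply/eqP => /(congr1 size); rewrite !size_cat => e; move: nnil.
  by rewrite -size_eq0 size_cat; lia.
rewrite ne orbF; have := diword_neq0 c; move: c.1 {ne} => u un0.
elim/(ltW_wf leW_monomial): u / un0 => u un0 ih; apply/negP => lt.
have vn0 : lw K ++ u ++ rw K != [::] by case: u un0 {ih lt} => // x u; case: (lw K).
by have /negP := ih _ vn0 lt; apply; apply: ltW_cat.
Qed.

Lemma ideal_lmul I a m f : is_ideal I -> I f ->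
  I (lmul (@dashv k X) a m f) /\ I (lmul (@vdash k X) a m f).
Proof.
move=> [_ _ Imul] If; case: a => [|x a]; first by split; exact: If.
by have [_ h2 _ h4] := Imul f (diw k (x :: a) m) If; split; [exact: h4 | exact: h2].
Qed.

Lemma ideal_rmul I b m f : is_ideal I -> I f ->
  I (rmul (@dashv k X) f b m) /\ I (rmul (@vdash k X) f b m).
Proof.
move=> [_ _ Imul] If; case: b => [|x b]; first by split; exact: If.
by have [h1 _ h3 _] := Imul f (diw k (x :: b) m) If; split; [exact: h3 | exact: h1].
Qed.

Lemma ideal_dlift I K f : is_ideal I -> I f -> I (dlift (act K) f).
Proof.
move=> I_ideal If; have [_ _ Imul] := I_ideal.
have Imid a b g : I g -> I (dlift (act (Mid a b)) g).
  move=> Ig; have -> : dlift (act (Mid a b)) g =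
      rmul (@dashv k X) (lmul (@vdash k X) a (size a) g) b 1.
    rewrite rmul_dashv lmul_vdash dlift_comp; apply: eq_dlift => d /=.
    by apply: diword_eqP; rewrite /= ?cats0 ?catA.
  apply: (proj1 (ideal_rmul _ _ I_ideal _)); exact: (proj2 (ideal_lmul _ _ I_ideal Ig)).
case: K => [a b|D b|a D]; first exact: Imid.
- have -> : dlift (act (Left D b)) f = dlift (act (Mid [::] b)) (dlift (act (Left D [::])) f).
    by rewrite dlift_comp; apply: eq_dlift => d; apply: diword_eqP; rewrite /= ?cats0 ?catA.
  by apply: Imid; rewrite -diw_dashv; have [] := Imul f (diw k D.1 D.2) If.
- have -> : dlift (act (Right a D)) f = dlift (act (Mid a [::])) (dlift (act (Right [::] D)) f).
    rewrite dlift_comp; apply: eq_dlift => d.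
    by apply: diword_eqP; rewrite /= ?cats0 ?catA // size_cat addnA.
  by apply: Imid; rewrite -vdash_diw; have [] := Imul f (diw k D.1 D.2) If.
Qed.

Lemma idealZ I a f : is_ideal I -> I f -> I (a *: f).
Proof. by case=> I0 IP _ If; rewrite -[_ *: _]addr0; apply: IP. Qed.

Lemma idealB I f g : is_ideal I -> I f -> I g -> I (f - g).
Proof. by case=> _ IP _ If Ig; rewrite addrC -scaleN1r; apply: IP. Qed.

Lemma ideal_nspan I S P f : is_ideal I -> S `<=` I -> nspan leW S P f -> I f.
Proof.
move=> Iid SI; elim=> [|a g f' [K [s [c [Ss _ _ _ ->]]]] _ ih]; first by case: Iid.
by have [_ IP _] := Iid; apply: IP ih; apply: ideal_dlift => //; exact: SI.
Qed.

Lemma nspan_support S P f d : nspan leW S P f -> d \in msupp f ->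
  exists2 e, P e & leD d e.
Proof.
elim=> [|a g f' [K [s [c [Ss ms okK Pc ->]]]] _ ih]; first by rewrite msupp0.
move=> /(fsubsetP (msuppD_le _ _)); rewrite inE => /orP[/(fsubsetP (msuppZ_le _ _))|//].
by move=> /(dlift_act_bound leW_monomial ms) le; exists (act K c).
Qed.

(** A combination has finitely many generators, so one of them has the largest leading diword. *)
Lemma nspan_bound S P f : nspan leW S P f ->
  f = 0 \/ exists K s c, [/\ S s, mlead s c, ok leW K s, P (act K c)
                           & nspan leW S (fun d => leD d (act K c)) f].
Proof.
elim=> [|a g f' [K [s [c [Ss ms okK Pc ->]]]] _ ih]; first by left.
right; have gen : nspan leW S (fun d => leD d (act K c)) (a *: dlift (act K) s).
  by apply: lspanZ; apply: nspan_gen ms okK _ => //; exact: leD_refl.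
case: ih => [->|[K' [s' [c' [Ss' ms' okK' Pc' Nf']]]]].
  by exists K, s, c; split=> //; rewrite addr0.
have [le|/negP le] := boolP (leD (act K c) (act K' c')).
  exists K', s', c'; split=> //; apply: lspanD => //.
  by apply: nspan_mono gen => d dle; exact: leD_trans le.
exists K, s, c; split=> //; apply: lspanD => //; apply: nspan_mono Nf' => d dle.
apply: leD_trans dle _ => //; apply: nltD => //; apply/negP => lt; apply: le.
exact: ltDW.
Qed.

Lemma cancel_mcoeffP a f g h c :
  (a *: f + g) - (a *: f + g)@_c *: h = a *: (f - f@_c *: h) + (g - g@_c *: h).
Proof.
by rewrite mcoeffD mcoeffZ scalerDl opprD addrACA -scalerA scalerBr.
Qed.

(** Induction on the largest leading diword [t] in a representation of [f]. If [t] is absent from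
    [f], the generators led by [t] can be replaced by their differences with a fixed one, which
    lowers the bound. *)
Lemma composition_diamond S f c : gs_basis leW S ->
  nspan leW S (fun=> True) f -> lead f = Some c ->
  exists2 s, S s & covered_by s c.
Proof.
move=> [S_monic S_trivial] /nspan_bound[->|]; first by rewrite lead0.
move=> [K [s [c0 [Ss ms okK _ Nf]]]] lf.
have [t et] : exists t, act K c0 = t by exists (act K c0).
rewrite et in Nf.
elim/(well_founded_ind (ltD_wf leW_monomial)): t K s c0 Ss ms okK et Nf =>
  t ih K s c0 Ss ms okK et Nf.
have mt := mlead_dlift leW_monomial ms okK; rewrite et in mt.
have [ft|ft0] := boolP (t \in msupp f).
  have : lead f = Some t.
    apply: leadP => // d /(nspan_support Nf)[e et' de]; exact: leD_trans et'.
  by rewrite lf => -[->]; exists s => //; exists K, c0.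
(* The subtracted expression is linear in [f], so the claim is proved term by term; afterwards the
   coefficient of [f] at [t] is 0. *)
have : nspan leW S (fun d => ltD d t) (f - f@_t *: dlift (act K) s).
  elim: Nf => [|a g f' [K' [s' [c' [Ss' ms' okK' le ->]]]] _ ih'].
    by rewrite mcoeff0 scale0r subr0; exact: lspan0.
  rewrite cancel_mcoeffP; apply: lspanD ih'; apply: lspanZ.
  have mg := mlead_dlift leW_monomial ms' okK'.
  case/leDP: le => [e|lt].
    have [+ _] := mg; rewrite e => ->; rewrite scale1r -e.
    apply: (nspan_same_lead leW_monomial S_monic S_trivial Ss' Ss ms' ms okK' okK).
    by rewrite e et.
  rewrite mcoeff_outdom ?scale0r ?subr0; first exact: nspan_gen ms' okK' lt.
  apply/negP => /(dlift_act_bound leW_monomial ms') /(leD_ltD_trans leW_monomial)/(_ lt).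
  by rewrite ltD_irr.
rewrite (mcoeff_outdom ft0) scale0r subr0 => /nspan_bound[f0|].
  by rewrite f0 lead0 in lf.
move=> [K' [s' [c' [Ss' ms' okK' lt Nf']]]].
exact: (ih _ lt K' s' c').
Qed.

Lemma gs_basis_ideal I S f : gs_basis_for leW I S -> I f ->
  nspan leW S (fun=> True) f.
Proof.
move=> [[Sm St] ->]; apply; split; first exact: nspan_ideal.
move=> s Ss; have /(dmonicP leW_monomial)[c ms] := Sm s Ss.
rewrite -[s](dlift_id) (_ : id = act (Mid [::] [::])); last first.
  by apply/funext => d; rewrite act_id.
exact: nspan_gen ms _ _.
Qed.

(** * Division by a set that covers all leading diwords of an ideal *)

Section Converse.
Variables (I S : set (Di k X)).
Hypotheses (I_ideal : is_ideal I) (SI : S `<=` I).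
Hypothesis S_monic : forall s, S s -> Defs.monic leW s.
Hypothesis S_covers : forall f c, I f -> lead f = Some c ->
  exists2 s, S s & covered_by s c.

(** Division: a normal S-diword cancels the leading term, and the remainder is in [I] with a smaller
    leading diword. *)
Lemma nspan_lead f c : I f -> lead f = Some c ->
  nspan leW S (fun d => leD d c) f.
Proof.
elim/(well_founded_ind (ltD_wf leW_monomial)): c f => c ih f If lf.
have [s Ss [K [d [ms okK ec]]]] := S_covers If lf.
have [cf cmax] := lead_max leW_monomial lf.
have mt := mlead_dlift leW_monomial ms okK; rewrite ec in mt.
have Nt : nspan leW S (fun d => leD d c) (dlift (act K) s).
  by apply: nspan_gen ms okK _ => //; rewrite ec leD_refl.
rewrite -[f](subrK (f@_c *: dlift (act K) s)); apply: lspanD; last exact: lspanZ.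
set r := f - _.
have Ir : I r by apply: idealB => //; apply: idealZ => //; apply: ideal_dlift => //; apply: SI.
case lr: (lead r) => [e|]; last by rewrite (lead_None leW_monomial lr); exact: lspan0.
have lt : ltD e c.
  have [er _] := lead_max leW_monomial lr.
  have ne : e != c.
    apply: contraTneq er => ->; rewrite -mcoeff_neq0 mcoeffB mcoeffZ.
    by have [-> _] := mt; rewrite mulr1 subrr eqxx.
  have [_ tmax] := mt.
  have /(fsubsetP (msuppB_le _ _)) := er; rewrite inE => /orP[/cmax/leDP[e1|//]|].
    by rewrite e1 eqxx in ne.
  by move=> /(fsubsetP (msuppZ_le _ _))/tmax/(_ ne).
by apply: nspan_mono (ih e lt r Ir lr) => d' le; apply/ltDW/(leD_ltD_trans leW_monomial le).
Qed.

Lemma ideal_ndiw s a b l : S s -> I (ndiw leW s a b l).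
Proof.
move=> /SI Is; rewrite /ndiw; case: ifP => _; last case: ifP => _.
- apply: (proj1 (ideal_rmul _ _ I_ideal _)); exact: (proj1 (ideal_lmul _ _ I_ideal Is)).
- apply: (proj1 (ideal_rmul _ _ I_ideal _)); exact: (proj2 (ideal_lmul _ _ I_ideal Is)).
- apply: (proj2 (ideal_rmul _ _ I_ideal _)); exact: (proj2 (ideal_lmul _ _ I_ideal Is)).
Qed.

Lemma ideal_composition h : composition leW S h -> I h.
Proof.
have [_ _ Imul] := I_ideal.
case=> *; try (by apply: idealB => //; try exact: ideal_ndiw; apply: SI).
- by match goal with Sf : S ?f |- I (?g ⊣ _) => have [] := Imul f g (SI Sf) end.
- by match goal with Sf : S ?f |- I (_ ⊢ ?g) => have [] := Imul f g (SI Sf) end.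
Qed.

(** Compositions lie in [I], so division yields the representation that triviality asks for. It also
    puts [I] inside every ideal containing [S]. *)
Lemma covering_gs_basis : gs_basis_for leW I S.
Proof.
split; [split=> // h /ideal_composition Ih|].
  apply: nspan_trivial => //; case lh: (lead h) => [c|]; last first.
    by rewrite (lead_None leW_monomial lh); exact: lspan0.
  exact: nspan_lead.
apply/seteqP; split=> f.
  move=> If J [Jid SJ]; case lf: (lead f) => [c|]; last first.
    by rewrite (lead_None leW_monomial lf); case: Jid.
  exact: (ideal_nspan Jid SJ (nspan_lead If lf)).
by move=> /(_ I); apply; split.
Qed.

End Converse.
End CompositionDiamond.

(** * The reduced basis *)

Section ReducedBasis.
Variables (k : fieldType) (X : choiceType) (leW : rel (seq X)).
Hypothesis leW_monomial : monomial_order leW.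
Variable I : set (Di k X).
Hypothesis I_ideal : is_ideal I.
Implicit Types (f g h s : Di k X) (c d e : diword X) (K : ctx X).
Implicit Types (S : set (Di k X)).

Local Notation lead := (lead leW).
Local Notation ltD := (ltD leW).
Local Notation leD := (leD leW).
Local Notation mlead := (mlead leW).
Local Notation covered_by := (covered_by leW).

Definition lead_ideal c : Prop := exists2 f, I f & mlead f c.

Lemma lead_idealP f c : I f -> lead f = Some c -> lead_ideal c.
Proof.
move=> If lf; exists ((f@_c)^-1 *: f); first exact: idealZ.
exact: lead_mlead.
Qed.

(** The tail is reduced against all of [I] and not against a basis, so that the element depends on
    [I], [c] and the ordering alone. *)
Definition redform c f : Prop :=
  [/\ I f, mlead f c & forall d, d \in msupp f -> d != c -> ~ lead_ideal d].

(** In the difference [c] cancels, so a nonzero difference would be led by a tail diword that is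
    forbidden to lead in [I]. *)
Lemma redform_uniq c f g : redform c f -> redform c g -> f = g.
Proof.
move=> [If mf rf] [Ig mg rg]; apply/eqP; rewrite -subr_eq0; apply/eqP.
case lr: (lead (f - g)) => [e|]; last exact: (lead_None leW_monomial).
have Le : lead_ideal e by apply: lead_idealP lr; exact: idealB.
have [er _] := lead_max leW_monomial lr.
have ne : e != c by apply: msuppB_neq er; [case: mf | case: mg].
have := fsubsetP (msuppB_le f g) e er; rewrite inE => /orP[/rf|/rg];
  by move=> /(_ ne)/(_ Le).
Qed.

(** Reduction from the top: a leading diword of [I] is cancelled by an element of [I], any other
    leading term is moved to [g]; the induction continues below it. *)
Lemma reduction e f : (forall d, d \in msupp f -> ltD d e) ->
  exists2 g : Di k X, I (f - g) & forall d, d \in msupp g -> ltD d e /\ ~ lead_ideal d.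
Proof.
have [I0 _ _] := I_ideal.
elim/(well_founded_ind (ltD_wf leW_monomial)): e f => e ih f fe.
case lf: (lead f) => [c|]; last first.
  by exists 0; [rewrite (lead_None leW_monomial lf) subr0 | rewrite msupp0].
have [cf cmax] := lead_max leW_monomial lf; have ce := fe c cf.
(* The claim serves both cases: [p] is an element of [I], or the bare diword [c]. *)
have red p : mlead p c -> forall d, d \in msupp (f - f@_c *: p) -> ltD d c.
  move=> [pc pmax] d df.
  have ne : d != c.
    apply: contraTneq df => ->.
    by rewrite -mcoeff_neq0 mcoeffB mcoeffZ pc mulr1 subrr eqxx.
  have := fsubsetP (msuppB_le _ _) d df; rewrite inE => /orP[/cmax/leDP[e1|//]|].
    by rewrite e1 eqxx in ne.
  by move=> /(fsubsetP (msuppZ_le _ _))/pmax/(_ ne).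
have [[p Ip mp]|nL] := pselect (lead_ideal c).
  have [g Ig gP] := ih c ce _ (red p mp).
  exists g; last by move=> d /gP[dc nd]; split=> //; exact: ltD_trans ce.
  have -> : f - g = f@_c *: p + (f - f@_c *: p - g).
    by move: (f@_c *: p) => x; rewrite addrA [x + _]addrC subrK.
  by have [_ IP _] := I_ideal; apply: IP.
have mc : mlead (<< c >> : Di k X) c.
  split=> [|d]; first by rewrite mcoeffUU.
  by rewrite msuppU oner_eq0 in_fset1 => ->.
have [g Ig gP] := ih c ce _ (red _ mc).
exists (f@_c *: (<< c >> : Di k X) + g); first by rewrite opprD addrA.
move=> d /(fsubsetP (msuppD_le _ _)); rewrite inE => /orP[/(fsubsetP (msuppZ_le _ _))|/gP[dc nd]].
  by rewrite msuppU oner_eq0 in_fset1 => /eqP ->.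
by split=> //; exact: ltD_trans ce.
Qed.

Lemma redform_ex c : lead_ideal c -> exists f, redform c f.
Proof.
(* Only the tail of [p] is reduced; its remainder stays below [c] and leaves the leading coefficient
   intact. *)
move=> [p Ip mp]; have [|g Ig gP] := @reduction c (p - (<< c >> : Di k X)).
  move=> d; rewrite (msupp_rest _ mp) => /andP[dp dc].
  by have [_ ->] := mp.
have gc : c \notin msupp g by apply/negP => /gP[]; rewrite ltD_irr.
have sup d : d \in msupp ((<< c >> : Di k X) + g) -> d != c -> d \in msupp g.
  move=> /(fsubsetP (msuppD_le _ _)); rewrite inE => /orP[|//].
  by rewrite msuppU oner_eq0 in_fset1 => ->.
exists ((<< c >> : Di k X) + g); split.
- have <- : p - (p - << c >> - g) = << c >> + g by rewrite -addrA -opprD subKr.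
  exact: idealB.
- split=> [|d dg ne]; last by have [] := gP d (sup d dg ne).
  by rewrite mcoeffD mcoeffUU (mcoeff_outdom gc) addr0.
- by move=> d dg ne; have [] := gP d (sup d dg ne).
Qed.

(* Leading diwords of the reduced basis; divisibility is tested only against the
   smaller leading diwords already retained, since being the leading diword of a normal
   diword is not transitive along elements that are not strong. *)
Definition basis_lead : diword X -> Prop :=
  Fix (ltD_wf leW_monomial) (fun=> Prop) (fun c rec =>
    lead_ideal c /\ forall d (lt : ltD d c), rec d lt ->
      forall f, redform d f -> ~ covered_by f c).

Lemma basis_leadE c : basis_lead c <->
  (lead_ideal c /\ forall d, ltD d c -> basis_lead d ->
    forall f, redform d f -> ~ covered_by f c).
Proof.
rewrite {1}/basis_lead Fix_eq // => d r r' err'.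
by have -> : r = r' by apply: functional_extensionality_dep => y;
  apply: functional_extensionality_dep => lt; exact: err'.
Qed.

Definition reduced_basis : set (Di k X) :=
  [set f | exists2 c, basis_lead c & redform c f].

Lemma covered_by_le f c d : mlead f d -> covered_by f c -> leD d c.
Proof.
move=> mf [K [d' [mf' _ <-]]].
have : Some d = Some d' by rewrite -(mlead_lead leW_monomial mf) (mlead_lead leW_monomial mf').
by case=> <-; exact: act_ge.
Qed.

Lemma covered_by_lead f c : mlead f c -> covered_by f c.
Proof. by move=> mf; exists (Mid [::] [::]), c; split=> //; rewrite act_id. Qed.

Lemma covered_lead_ideal f c : I f -> covered_by f c -> lead_ideal c.
Proof.
move=> If [K [d [mf okK <-]]]; exists (dlift (act K) f); first exact: ideal_dlift.
exact: mlead_dlift.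
Qed.

Lemma reduced_basis_monic s : reduced_basis s -> Defs.monic leW s.
Proof. by move=> [c _ [_ ms _]]; apply/(dmonicP leW_monomial); exists c. Qed.

(** If [c] is not retained, the failing clause of the recursion is precisely a covering by an
    element with a smaller retained leading diword. *)
Lemma reduced_basis_covers c : lead_ideal c ->
  exists2 s, reduced_basis s & covered_by s c.
Proof.
move=> Lc; have [f rf] := redform_ex Lc.
have [Mc|nM] := pselect (basis_lead c).
  by exists f; [exists c | case: rf => _ mf _; exact: covered_by_lead].
apply: contrapT => nex; apply: nM; apply/basis_leadE; split=> // d lt Md g rg cg.
by apply: nex; exists g => //; exists d.
Qed.

Lemma reduced_basisP : reduced_gs_basis_for leW I reduced_basis.
Proof.
split.
  apply: covering_gs_basis => //.
  - by move=> s [c _ []].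
  - exact: reduced_basis_monic.
  - by move=> f c If lf; apply: reduced_basis_covers; apply: lead_idealP lf.
move=> s [c Mc [Is ms rs]] e es; apply/IrrP => //.
  by move=> s' [/reduced_basis_monic].
move=> [s' [[c' Mc' rs'] ns] cov]; have [Is' ms' _] := rs'.
(* A tail diword is protected by [redform], the leading one by the recursion and the uniqueness of
   reduced forms. *)
have [ec|ne] := eqVneq e c; last exact: rs es ne (covered_lead_ideal Is' cov).
rewrite {}ec in cov es; case/leDP: (covered_by_le ms' cov) => [ec|lt].
  by apply: ns; apply: (@redform_uniq c); [rewrite -ec | split].
by have /basis_leadE[_ /(_ _ lt Mc' _ rs')] := Mc.
Qed.

Lemma reduced_basis_uniq S : reduced_gs_basis_for leW I S -> reduced_basis = S.
Proof.
move=> [gsI Sred]; have [gs IS] := gsI; have [Sm _] := gs.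
have SI s : S s -> I s by move=> Ss; rewrite IS => J [_]; exact.
have cov c : lead_ideal c -> exists2 s, S s & covered_by s c.
  move=> [f If mf]; apply: (composition_diamond leW_monomial gs).
    exact: (gs_basis_ideal leW_monomial gsI If).
  exact: mlead_lead.
have Sm' s t : (S `\ s) t -> Defs.monic leW t by move=> [/Sm].
(* Reducedness says that an element covering a diword in the support of [s] is [s] itself. *)
have irr s t c : S s -> S t -> c \in msupp s -> covered_by t c -> t = s.
  move=> Ss St cs ct; apply: contrapT => nts.
  by have /(IrrP leW_monomial _ (Sm' s)) := Sred s Ss c cs; apply; exists t.
(* A tail diword leading in [I] would be covered by [s] itself, yet [s] covers nothing below its
   leading diword. *)
have Srf s c : S s -> mlead s c -> redform c s.
  move=> Ss ms; split=> // [|d ds ne Ld]; first exact: SI.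
  have [t St ct] := cov d Ld; have ets := irr _ _ _ Ss St ds ct; rewrite ets in ct.
  have [_ /(_ d ds ne)/(leD_ltD_trans leW_monomial (covered_by_le ms ct))] := ms.
  by rewrite ltD_irr.
(* The leading diwords of [S] obey the recursion of [basis_lead], so well-founded induction
   identifies the two sets. *)
have ML c : basis_lead c <-> exists2 s, S s & mlead s c.
  elim/(well_founded_ind (ltD_wf leW_monomial)): c => c ih.
  split=> [/basis_leadE[Lc nc]|[s Ss ms]].
    have [s Ss cs] := cov c Lc; have /(dmonicP leW_monomial)[d ms] := Sm s Ss.
    case/leDP: (covered_by_le ms cs) => [<-|lt]; first by exists s.
    have Md : basis_lead d by apply/(ih d lt); exists s.
    by case: (nc d lt Md s (Srf s d Ss ms)).
  apply/basis_leadE; split; first by exists s => //; exact: SI.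
  move=> d lt /(ih d lt)[t St mt] f rf cf.
  have eft := redform_uniq rf (Srf t d St mt); rewrite eft in cf.
  have ets := irr _ _ _ Ss St (mlead_supp ms) cf; rewrite ets in mt.
  have : Some c = Some d by rewrite -(mlead_lead leW_monomial ms) (mlead_lead leW_monomial mt).
  by case=> e; rewrite e ltD_irr in lt.
apply/seteqP; split=> s.
  move=> [c /ML[t St mt] rs]; by rewrite (redform_uniq rs (Srf t c St mt)).
move=> Ss; have /(dmonicP leW_monomial)[c ms] := Sm s Ss.
by exists c; [apply/ML; exists s | exact: Srf].
Qed.

End ReducedBasis.

Theorem theorem3p22 (k : fieldType) (X : choiceType)
    (leX : rel X) (leX_wo : well_order leX)
    (leW : rel (seq X)) (leW_monomial : monomial_order leW)
    (I : set (Di k X)) (I_ideal : is_ideal I) :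
  exists! S : set (Di k X), reduced_gs_basis_for leW I S.
Proof.
exists (reduced_basis leW_monomial I); split; first exact: reduced_basisP.
by move=> S; exact: reduced_basis_uniq.
Qed.
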